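(* There is an absolute constant $c>0$ such that the following holds. Let $(\mathcal{A},E)$ be a non-commutative probability space, let $n\ge1$, and let $X_1,\dots,X_n\in\mathcal{A}$ be free identically-distributed random variables (not necessarily self-adjoint) with $E(X_i^*X_i)\neq 0$. Let $\Pi_n=X_1X_2\cdots X_n$ and $$\gamma=\sigma\left(\frac{X_i^*X_i}{E(X_i^*X_i)}\right)\ge 0.$$ Then: (1) $\|\Pi_n\|\le c\,\|X_i\|\,\sqrt{n}\,\left[E(X_i^*X_i)\right]^{(n-1)/2}$; and (2) $\|\Pi_n\|\ge \gamma^{1/2}n^{1/4}\left[E(X_i^*X_i)\right]^{n/2}$.
   Context: A non-commutative probability space $(\mathcal{A},E)$ is a unital $C^*$-algebra $\mathcal{A}$ with a positive linear functional $E$ such that $E(I)=1$ and which is tracial: $E(AB)=E(BA)$ for all $A,B\in\mathcal{A}$. It is assumed that $E$ is faithful ($E(A^*A)=0$ implies $A=0$), so that for a positive $A$ the norm $\|A\|$ is the smallest $t$ such that the spectral measure of $A$ is supported in $[0,t]$. Elements of $\mathcal{A}$ are called random variables; $\|\cdot\|$ is the operator ($C^*$-) norm. Freeness: unital subalgebras $\mathcal{A}_1,\dots,\mathcal{A}_r$ of $\mathcal{A}$ are free if $E(a_1\cdots a_m)=0$ whenever $a_i\in\mathcal{A}_{k(i)}$, $E(a_i)=0$ for all $i$, $k(i)\ne k(i+1)$ for every $i<m$, and $k(m)\neq k(1)$. (Since $E$ is tracial, this is equivalent to the usual definition without the condition $k(m)\ne k(1)$.) Elements (not necessarily self-adjoint)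 are free if the unital $*$-subalgebras they generate are free. Variables $X_i$ are identically distributed if all mixed moments of $(X_i,X_i^* )$ under $E$ do not depend on $i$ (then $\|X_i\|$, $E(X_i^*X_i)$ and $\gamma$ do not depend on $i$). Variance: $\sigma^2(A)=E(A^*A)-|E(A)|^2$, $\sigma(A)=\sqrt{\sigma^2(A)}\ge0$. *)

(* Defs.v *)
From HB Require Import structures.
From mathcomp Require Import all_boot all_order all_algebra.
From mathcomp Require Import complex.
From mathcomp Require Import all_classical all_reals all_analysis.

Set Implicit Arguments.
Unset Strict Implicit.
Unset Printing Implicit Defensive.

Import Order.TTheory GRing.Theory Num.Theory.
Import numFieldNormedType.Exports.

Local Open Scope classical_set_scope.
Local Open Scope ring_scope.

(* Unital C*-algebras over the complex field R[i].  The norm is a field of this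
   structure, valued in R, and not the one of [normedModType R[i]]: Hierarchy
   Builder rejects a structure joining [GRing.Algebra] and [NormedModule],
   because [Num.NumDomain] already inherits from a ring and from a normed
   Z-module that have no common join below it. *)
HB.mixin Record isCStarAlgebra (R : realType) A of GRing.Algebra R[i] A := {
  opnorm : A -> R;
  star : A -> A;
  opnorm0_eq0 : forall x : A, opnorm x = 0 -> x = 0;
  opnormZ : forall (a : R[i]) (x : A),
    opnorm (a *: x) = Normc.normc a * opnorm x;
  opnormD_le : forall x y : A, opnorm (x + y) <= opnorm x + opnorm y;
  opnormM_le : forall x y : A, opnorm (x * y) <= opnorm x * opnorm y;
  opnorm_complete : forall u : nat -> A,
    (forall e : R, 0 < e -> exists N : nat, forall m n : nat,
       (N <= m)%N -> (N <= n)%N -> opnorm (u m - u n) < e) ->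
    exists l : A, opnorm (u n - l) @[n --> \oo] --> (0 : R);
  starD : {morph star : x y / x + y};
  starZ : forall (a : R[i]) (x : A), star (a *: x) = a^* *: star x;
  starM : forall x y : A, star (x * y) = star y * star x;
  starK : involutive star;
  opnorm_starM : forall x : A, opnorm (star x * x) = opnorm x ^+ 2
}.

#[short(type="cstarAlgType")]
HB.structure Definition CStarAlgebra (R : realType) :=
  {A of isCStarAlgebra R A & GRing.Algebra R[i] A}.

Section NCProbability.
Variables (R : realType) (A : cstarAlgType R).
Implicit Types (E : {scalar A}) (x : A) (S : set A).

(* The order on R[i] satisfies [0 <= z] iff z is real and nonnegative, and the
   positive elements of a C*-algebra are those of the form [star x * x]. *)
Record nc_probability E : Prop := {
  nc_positive : forall x, 0 <= E (star x * x);
  nc_unit : E 1 = 1;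
  nc_tracial : forall x y, E (x * y) = E (y * x);
  nc_faithful : forall x, E (star x * x) = 0 -> x = 0
}.

Definition star_subalgebra S : Prop :=
  GRing.subalg_closed (mem S) /\ {in S, forall x, star x \in S}.

Definition gen_star_subalgebra x : set A := smallest star_subalgebra [set x].

(* Indices run over ['I_m.+1] because the empty product must be excluded:
   [E 1 = 1].  The condition [k ord_max != k ord0] is harmless for a tracial
   [E]. *)
Definition free_subalgebras (I : eqType) E (B : I -> set A) : Prop :=
  forall (m : nat) (k : 'I_m.+1 -> I) (a : 'I_m.+1 -> A),
    (forall i, a i \in B (k i)) ->
    (forall i, E (a i) = 0) ->
    (forall i j : 'I_m.+1, j = i.+1 :> nat -> k i != k j) ->
    k ord_max != k ord0 ->
    E (\prod_(i < m.+1) a i) = 0.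

Definition free_variables (I : eqType) E (X : I -> A) : Prop :=
  free_subalgebras E (fun i => gen_star_subalgebra (X i)).

(* A word in the letters x, x^* is a sequence of booleans, [true] standing for
   x^*. *)
Definition mixed_moment E x (w : seq bool) : R[i] :=
  E (\prod_(b <- w) (if b then star x else x)).

Definition identically_distributed (I : Type) E (X : I -> A) : Prop :=
  forall (i j : I) (w : seq bool),
    mixed_moment E (X i) w = mixed_moment E (X j) w.

(* E(x^* x) as a real number; it is nonnegative by [nc_positive]. *)
Definition second_moment E x : R := complex.Re (E (star x * x)).

Definition variance E x : R := second_moment E x - Normc.normc (E x) ^+ 2.

Definition stddev E x : R := Num.sqrt (variance E x).

Definition gamma E x : R := stddev E ((E (star x * x))^-1 *: (star x * x)).

End NCProbability.

(* Main.v *)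
(* Normalise E(X^*X) = 1 and let P_n be Pi_n^* Pi_n, so that by traciality P_(n+1)
   has the moments of a P_n, with a = X X^* free from P_n.

   Lower bound: Var(ab) = Var(a) + Var(b) for free a, b of mean 1, hence
   E(P_n^2) = 1 + n gamma^2, while E(P_n^2) <= ||P_n||^2.

   Upper bound: if a and b are free and the moment series of z1 a and z2 b have the
   same sum u, then so has z ab with z = z1 z2 (1 + u) / u, because for
   x = f - E f, y = g - E g, f = (1 - z1 a)^-1 and g = (1 - z2 b)^-1,
      f (1 - z ab) g = (1 + u) - x y / u,
   and freeness kills E(g (x y)^k f) for k > 0.  So the moment series of P_n at z is
   that of a at w, where w = z kappa(w)^(n-1) and kappa(w) = u / (w (1 + u)).  The
   coefficients of kappa are dominated by those of 1 / (1 - 2 L w), L = ||a||, so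
   those of w(z) are dominated by a series converging at z = 1 / (8 L n); hence
   E(P_n^k) <= 2 (8 L n)^k, which bounds ||P_n|| by faithfulness of E.

   The identities between power series are proved for truncated series, modulo
   O(s^(M+1)), so that no limit in the algebra is needed. *)

Require Import Defs.
From mathcomp Require Import all_boot all_order all_algebra.
From mathcomp Require Import complex.
From mathcomp Require Import all_classical all_reals all_analysis.
From mathcomp Require Import ring lra zify.
From Stdlib Require Ncring Ncring_tac.

Set Implicit Arguments.
Unset Strict Implicit.
Unset Printing Implicit Defensive.

Import Order.TTheory GRing.Theory Num.Theory.
Import numFieldNormedType.Exports.

Local Open Scope ring_scope.

(** The rule z = z1 z2 (1 + u) / u is Voiculescu's multiplicativity of the S-transform: S_a(u) = z1
    (1 + u) / u, and kappa = 1 / S_a. For n factors it is applied n - 1 times, to [a k] and [P k],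
    which gives z = w S_a(u)^(n-1). Linear growth in n comes from taking w of order 1 / (L n): there
    the majorant of kappa is 1 + O(1/n), so its (n-1)-st power stays bounded. This needs first
    moment 1 and the bound L^j on the (j+1)-st moment of a, one power of L better than the trivial
    bound; otherwise kappa^(n-1) would grow exponentially. The norm is never read off a spectrum. A
    self-adjoint element is bounded by completing it to a multiple of a unitary, with square roots
    obtained by iteration; and a moment bound C t^(2k) becomes a norm bound by a convexity argument
    in k, in which the size of C does not matter. *)

#[local] Instance nzring_ops (S : nzRingType) :
  @Ncring.Ring_ops S 0 1 (@GRing.add S) (@GRing.mul S) (fun x y => x - y)
    (@GRing.opp S) (@eq S) := {}.

#[local] Instance nzring_ring (S : nzRingType) :
  @Ncring.Ring S _ _ _ _ _ _ _ (nzring_ops S).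
Proof.
constructor; rewrite /Algebra_syntax.equality /Ncring.eq_notation
  /Algebra_syntax.addition /Ncring.add_notation
  /Algebra_syntax.multiplication /Ncring.mul_notation
  /Algebra_syntax.subtraction /Ncring.sub_notation
  /Algebra_syntax.opposite /Ncring.opp_notation;
  try by [move=> x y -> | move=> x y -> z t ->].
- exact: RelationClasses.eq_equivalence.
- exact: add0r.
- exact: addrC.
- exact: addrA.
- exact: mul1r.
- exact: mulr1.
- exact: mulrA.
- by move=> *; exact: mulrDl.
- by move=> *; exact: mulrDr.
- by [].
- exact: subrr.
Qed.

Ltac ncring := Ncring_tac.non_commutative_ring.

Section ComplexFacts.
Variable R : realType.
Implicit Types (x y : R[i]) (r : R).

Lemma ReD x y : complex.Re (x + y) = complex.Re x + complex.Re y.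
Proof. by case: x; case: y. Qed.

Lemma Re_rM r x : complex.Re (r%:C%C * x) = r * complex.Re x.
Proof. by case: x => a b /=; rewrite mul0r subr0. Qed.

Lemma normc_real r : Normc.normc r%:C%C = `|r|.
Proof. by rewrite /= expr0n addr0 sqrtr_sqr. Qed.

Lemma conj_real r : (r%:C%C : R[i])^* = r%:C%C.
Proof. exact: conjc_real. Qed.

Lemma ge0_realE x : 0 <= x -> x = (complex.Re x)%:C%C.
Proof. by move=> x0; rewrite RRe_real // ger0_real. Qed.

End ComplexFacts.

(** * C*-algebras and tracial states *)

Section CStarFacts.
Variables (R : realType) (A : cstarAlgType R).
Implicit Types (x y z h c b : A) (r t : R).

Definition rscale r x : A := r%:C%C *: x.
Local Notation "r *:: x" := (rscale r x) (at level 40).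

Lemma rscaleD r x y : r *:: (x + y) = r *:: x + r *:: y.
Proof. exact: scalerDr. Qed.
Lemma rscaleB r x y : r *:: (x - y) = r *:: x - r *:: y.
Proof. exact: scalerBr. Qed.
Lemma rscaleDl r t x : (r + t) *:: x = r *:: x + t *:: x.
Proof. by rewrite /rscale rmorphD /= scalerDl. Qed.
Lemma rscaleA r t x : r *:: (t *:: x) = (r * t) *:: x.
Proof. by rewrite /rscale rmorphM /= scalerA. Qed.
Lemma rscale1 x : 1 *:: x = x.
Proof. by rewrite /rscale rmorph1 scale1r. Qed.
Lemma rscale0 x : 0 *:: x = 0.
Proof. by rewrite /rscale rmorph0 scale0r. Qed.
Lemma rscaleNl r x : (- r) *:: x = - (r *:: x).
Proof. by rewrite /rscale rmorphN /= scaleNr. Qed.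
Lemma rscaleAl r x y : (r *:: x) * y = r *:: (x * y).
Proof. by rewrite /rscale scalerAl. Qed.
Lemma rscaleAr r x y : x * (r *:: y) = r *:: (x * y).
Proof. by rewrite /rscale scalerAr. Qed.
Lemma rscale2 x : 2 *:: x = x + x.
Proof. by rewrite rscaleDl rscale1. Qed.
Lemma rscaleXn r x k : (r *:: x) ^+ k = (r ^+ k) *:: (x ^+ k).
Proof. by rewrite /rscale exprZn rmorphXn. Qed.
Lemma star_rscale r x : star (r *:: x) = r *:: star x.
Proof. by rewrite /rscale starZ conj_real. Qed.
Lemma star0 : star (0 : A) = 0.
Proof. by apply: (addrI (star 0)); rewrite -starD !addr0. Qed.

Lemma starN x : star (- x) = - star x.
Proof. by apply: (addrI (star x)); rewrite -starD !subrr star0. Qed.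

Lemma starB x y : star (x - y) = star x - star y.
Proof. by rewrite starD starN. Qed.

Lemma star1 : star (1 : A) = 1.
Proof. by rewrite -[LHS]mulr1 -[X in _ * X]starK -starM mulr1 starK. Qed.

Lemma starX x k : star (x ^+ k) = star x ^+ k.
Proof. by elim: k => [|k IH]; rewrite ?expr0 ?star1 // exprS starM IH exprSr. Qed.

Lemma opnorm_rscale r x : opnorm (r *:: x) = `|r| * opnorm x.
Proof. by rewrite /rscale opnormZ normc_real. Qed.

Lemma opnorm0 : opnorm (0 : A) = 0.
Proof. by rewrite -(rscale0 0) opnorm_rscale normr0 mul0r. Qed.

Lemma opnormN x : opnorm (- x) = opnorm x.
Proof. by rewrite -[x in - x]rscale1 -rscaleNl opnorm_rscale normrN1 mul1r. Qed.

Lemma opnorm_ge0 x : 0 <= opnorm x.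
Proof.
have := opnormD_le x (- x); rewrite subrr opnorm0 opnormN; lra.
Qed.

Lemma opnormB_le x y : opnorm (x - y) <= opnorm x + opnorm y.
Proof. by rewrite -(opnormN y); apply: opnormD_le. Qed.

Lemma opnorm_star x : opnorm (star x) = opnorm x.
Proof.
have H z : opnorm z <= opnorm (star z).
  have [->|z0] := eqVneq (opnorm z) 0; first exact: opnorm_ge0.
  have zp : 0 < opnorm z by rewrite lt_def z0 opnorm_ge0.
  rewrite -(ler_pM2r zp) -expr2 -opnorm_starM; exact: opnormM_le.
by apply/eqP; rewrite eq_le H -{2}(starK x) H.
Qed.

Lemma opnorm_sa_sqr h : star h = h -> opnorm (h * h) = opnorm h ^+ 2.
Proof. by move=> {1}<-; exact: opnorm_starM. Qed.

Lemma opnorm1_le : opnorm (1 : A) <= 1.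
Proof.
have := opnorm_sa_sqr star1; rewrite mulr1; have := opnorm_ge0 1.
set a := opnorm _ => a0 e; rewrite leNgt; apply/negP => a1; nra.
Qed.

Lemma opnormX_le x k : opnorm (x ^+ k) <= opnorm x ^+ k.
Proof.
elim: k => [|k IH]; first by rewrite !expr0 opnorm1_le.
rewrite !exprS; apply: le_trans (opnormM_le _ _) _.
by apply: ler_wpM2l => //; apply: opnorm_ge0.
Qed.

Lemma opnorm_eq0 x : (forall e, 0 < e -> opnorm x <= e) -> x = 0.
Proof.
move=> H; apply: opnorm0_eq0; apply/eqP; rewrite eq_le opnorm_ge0 andbT.
rewrite leNgt; apply/negP => x0.
have := H (opnorm x / 2); lra.
Qed.

(* The square root is [1 - r] for a fixed point [r] of [r |-> (h + r^2) / 2];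
   the increments of the iterates in [A] are dominated by those of the scalar
   iteration with [h = 1], which is increasing and bounded. *)
Lemma sqrt_one_sub h : star h = h -> opnorm h <= 1 ->
  exists s, [/\ star s = s, s * s = 1 - h, opnorm (1 - s) <= 1 &
                forall y, y * h = h * y -> y * s = s * y].
Proof.
move=> hs h1.
pose r := fix r k : A := if k is k'.+1 then 2^-1 *:: (h + r k' * r k') else 0.
pose rho := fix rho k : R := if k is k'.+1 then 2^-1 * (1 + rho k' * rho k') else 0.
have rho01 k : 0 <= rho k <= 1 by elim: k => [|k IH] /=; [lra|nra].
have rhoS k : rho k <= rho k.+1.
  by have := rho01 k => /=; set a := rho k => ?; have := sqr_ge0 (1 - a); nra.
have rho_le : {homo rho : n k / (n <= k)%N >-> n <= k} := homo_leq lexx le_trans rhoS.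
have r_sa k : star (r k) = r k.
  by elim: k => [|k IH] /=; rewrite ?star0 // star_rscale starD starM hs IH.
have r_comm k y : y * h = h * y -> y * r k = r k * y.
  move=> yh; elim: k => [|k IH] /=; first by rewrite mulr0 mul0r.
  by rewrite rscaleAr rscaleAl mulrDr mulrDl yh mulrA IH -mulrA IH mulrA.
have r_norm k : opnorm (r k) <= rho k.
  elim: k => [|k IH] /=; first by rewrite opnorm0.
  rewrite opnorm_rscale ger0_norm ?invr_ge0 //.
  rewrite ler_pM2l ?invr_gt0 //; apply: le_trans (opnormD_le _ _) _.
  apply: lerD => //; apply: le_trans (opnormM_le _ _) _.
  by apply: ler_pM => //; apply: opnorm_ge0.
have r_incr k : opnorm (r k.+1 - r k) <= rho k.+1 - rho k.
  elim: k => [|k IH].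
    rewrite subr0 subr0; exact: (r_norm 1%N).
  have -> : r k.+2 - r k.+1 = 2^-1 *:: ((r k.+1 - r k) * (r k.+1 + r k)).
    rewrite /= -rscaleB; congr (_ *:: _); rewrite -/(r k.+1).
    (* [h] commutes with itself, hence with [r k]; so [r k] commutes with [h], hence with every
       iterate. *)
    have e : r k * r k.+1 = r k.+1 * r k by exact: (r_comm _ _ (esym (r_comm k h erefl))).
    by rewrite mulrDr !mulrBl e; ncring.
  have -> : rho k.+2 - rho k.+1 = 2^-1 * ((rho k.+1 - rho k) * (rho k.+1 + rho k)).
    by rewrite /=; ring.
  rewrite opnorm_rscale ger0_norm ?invr_ge0 // ler_pM2l ?invr_gt0 //.
  apply: le_trans (opnormM_le _ _) _; apply: ler_pM => //; try exact: opnorm_ge0.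
  by apply: le_trans (opnormD_le _ _) _; apply: lerD.
have r_dist n k : (n <= k)%N -> opnorm (r k - r n) <= rho k - rho n.
  move=> /subnKC <-; elim: (k - n)%N => [|j IH].
    by rewrite addn0 !subrr opnorm0.
  rewrite addnS; have := r_incr (n + j)%N => H.
  have -> : r (n + j).+1 - r n = (r (n + j).+1 - r (n + j)%N) + (r (n + j)%N - r n).
    by rewrite addrA subrK.
  apply: le_trans (opnormD_le _ _) _; lra.
have rho_cauchy e : 0 < e -> exists N : nat, forall k, (N <= k)%N -> rho k - rho N < e.
  move=> e0; have hS : has_sup (range rho).
    split; first by exists (rho 0%N), 0%N.
    by exists 1 => _ [k _ <-]; case/andP: (rho01 k).
  have [_ [N _ <-] HN] := sup_adherent e0 hS.
  exists N => k Nk; have : rho k <= sup (range rho).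
    by apply: sup_upper_bound => //; exists k.
  lra.
have [l Hl] : exists l : A, (opnorm (r n - l) @[n --> \oo] --> (0 : R))%classic.
  apply: opnorm_complete => e e0.
  have [|N HN] := rho_cauchy (e / 2); first by lra.
  exists N => m n Nm Nn.
  have -> : r m - r n = (r m - r N) - (r n - r N) by rewrite opprB addrA subrK.
  apply: le_lt_trans (opnormB_le _ _) _.
  have := r_dist _ _ Nm; have := r_dist _ _ Nn; have := HN _ Nm; have := HN _ Nn.
  lra.
have {}Hl e : 0 < e -> exists k, opnorm (r k - l) < e /\ opnorm (r k.+1 - l) < e.
  move=> e0; move/cvgrPdist_lt: Hl => /(_ e e0) [N _ HN].
  exists N; split.
    by have := HN N (leqnn _); rewrite /= sub0r normrN ger0_norm ?opnorm_ge0.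
  by have := HN N.+1 (leqnSn _); rewrite /= sub0r normrN ger0_norm ?opnorm_ge0.
have l1 : opnorm l <= 1.
  apply/ler_addgt0Pr => e e0; have [k [Hk _]] := Hl e e0.
  have -> : l = r k - (r k - l) by rewrite opprB addrCA subrr addr0.
  apply: le_trans (opnormB_le _ _) _.
  have := r_norm k; have := rho01 k; lra.
have lsa : star l = l.
  apply/eqP; rewrite -subr_eq0; apply/eqP/opnorm_eq0 => e e0.
  have [|k [Hk _]] := Hl (e / 2); first by lra.
  have -> : star l - l = (r k - l) - star (r k - l).
    by rewrite starB r_sa opprB [RHS]addrC addrA subrK.
  apply: le_trans (opnormB_le _ _) _; rewrite opnorm_star; lra.
have lc y : y * h = h * y -> y * l = l * y.
  move=> yh; apply/eqP; rewrite -subr_eq0; apply/eqP/opnorm_eq0 => e e0.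
  have c0 : 0 < 2 * (opnorm y + 1) by have := opnorm_ge0 y; lra.
  have [|k [Hk _]] := Hl (e / (2 * (opnorm y + 1))); first by rewrite divr_gt0.
  have -> : y * l - l * y = (r k - l) * y - y * (r k - l).
    by rewrite mulrBr mulrBl opprB r_comm // [RHS]addrC addrA subrK.
  apply: le_trans (opnormB_le _ _) _.
  have := opnormM_le (r k - l) y; have := opnormM_le y (r k - l).
  move: Hk; rewrite ltr_pdivlMr // => Hk.
  have := opnorm_ge0 y; have := opnorm_ge0 (r k - l); nra.
have lE : l + l = h + l * l.
  apply/eqP; rewrite -subr_eq0; apply/eqP/opnorm_eq0 => e e0.
  have [|k [Hk HSk]] := Hl (e / 4); first by lra.
  have e1 : r k.+1 + r k.+1 = h + r k * r k.
    rewrite -rscale2 /= rscaleA divff ?rscale1 // pnatr_eq0 //.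
  have -> : l + l - (h + l * l) =
     ((r k - l) * r k + l * (r k - l)) - ((r k.+1 - l) + (r k.+1 - l)).
    transitivity (r k * r k - l * l - (r k.+1 + r k.+1) + l + l); last by ncring.
    by rewrite e1; ncring.
  apply: le_trans (opnormB_le _ _) _.
  have n1 := opnormD_le ((r k - l) * r k) (l * (r k - l)).
  have n2 := opnormD_le (r k.+1 - l) (r k.+1 - l).
  have n3 := opnormM_le (r k - l) (r k); have n4 := opnormM_le l (r k - l).
  have n5 := r_norm k; have n6 := rho01 k.
  have := opnorm_ge0 (r k - l); have := opnorm_ge0 (r k); nra.
exists (1 - l); split.
- by rewrite starB star1 lsa.
- have -> : h = l + l - l * l by rewrite lE addrK.
  by ncring.
- by rewrite opprB addrCA subrr addr0.
- by move=> y yh; rewrite mulrBr mulrBl mulr1 mul1r lc.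
Qed.

End CStarFacts.

Local Notation "r *:: x" := (rscale r x) (at level 40).

Section StateFacts.
Variables (R : realType) (A : cstarAlgType R) (E : {scalar A}).
Hypothesis E_prob : nc_probability E.
Implicit Types (x y z h c b : A) (r t : R).

(** As [c] and [d] commute, c + i d and c - i d are both [t] times a unitary, so the C*-identity
    bounds their norms by [t]; and [c] is their mean. *)
Lemma opnorm_unitary c d t : 0 <= t -> star c = c -> star d = d ->
  c * d = d * c -> c * c + d * d = (t ^+ 2) *:: 1 -> opnorm c <= t.
Proof.
move=> t0 cs ds cd e.
have i2 : ('i%C : R[i]) * 'i%C = -1 by rewrite -expr2 sqr_i.
have nrm w : star w * w = (t ^+ 2) *:: 1 -> opnorm w <= t.
  move=> ew; have : opnorm w ^+ 2 <= t ^+ 2.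
    rewrite -opnorm_starM ew opnorm_rscale ger0_norm ?sqr_ge0 //.
    by rewrite ler_piMr ?sqr_ge0 // opnorm1_le.
  by rewrite ler_pXn2r // nnegrE opnorm_ge0.
pose v := 'i%C *: d.
have vs : star v = - v.
  rewrite /v starZ ds -scaleNr; congr (_ *: _).
  by apply/eqP; rewrite eq_complex /= oppr0 !eqxx.
have vv : v * v = - (d * d) by rewrite /v -scalerAl -scalerAr scalerA i2 scaleN1r.
have cv : c * v = v * c by rewrite /v -scalerAl -scalerAr cd.
have h1 : opnorm (c + v) <= t.
  apply: nrm; rewrite starD vs cs -e -[d * d]opprK -vv.
  by rewrite mulrDr !mulrDl cv; ncring.
have h2 : opnorm (c - v) <= t.
  apply: nrm; rewrite starB vs cs -e -[d * d]opprK -vv.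
  by rewrite mulrBr !mulrBl !mulNr cv; ncring.
have -> : c = 2^-1 *:: ((c + v) + (c - v)).
  rewrite addrACA subrr addr0 -rscale2 rscaleA mulVf ?rscale1 // pnatr_eq0 //.
rewrite opnorm_rscale ger0_norm ?invr_ge0 //.
have := opnormD_le (c + v) (c - v); lra.
Qed.

(** Write 1 - c^2 as s^2; then s^2 + c^2 = 1, so [s] is a contraction by [opnorm_unitary]. *)
Lemma opnorm_one_sub_sqr c : star c = c -> opnorm c <= 1 ->
  opnorm (1 - c * c) <= 1.
Proof.
move=> cs c1.
have [||s [ss s2 _ sc]] := @sqrt_one_sub _ _ (c * c).
- by rewrite starM cs.
- by rewrite opnorm_sa_sqr // expr_le1 // opnorm_ge0.
rewrite -s2 opnorm_sa_sqr // expr_le1 ?opnorm_ge0 //.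
apply: (@opnorm_unitary s c) => //; first by rewrite sc // mulrA.
by rewrite s2 expr1n rscale1 subrK.
Qed.

Definition tau x : R := complex.Re (E x).

Lemma tauD x y : tau (x + y) = tau x + tau y.
Proof. by rewrite /tau linearD ReD. Qed.

Lemma tau_rscale r x : tau (r *:: x) = r * tau x.
Proof. by rewrite /tau linearZ /= Re_rM. Qed.

Lemma tauN x : tau (- x) = - tau x.
Proof. by rewrite -[x in LHS]rscale1 -rscaleNl tau_rscale mulN1r. Qed.

Lemma tauB x y : tau (x - y) = tau x - tau y.
Proof. by rewrite tauD tauN. Qed.

Lemma tau0 : tau 0 = 0.
Proof. by rewrite -(subrr 0) tauB subrr. Qed.

Lemma tau_sum (I : Type) (s : seq I) (P : pred I) (F : I -> A) :
  tau (\sum_(i <- s | P i) F i) = \sum_(i <- s | P i) tau (F i).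
Proof. exact: (big_morph tau tauD tau0). Qed.

Lemma tau1 : tau 1 = 1.
Proof. by rewrite /tau (nc_unit E_prob). Qed.

Lemma tauC x y : tau (x * y) = tau (y * x).
Proof. by rewrite /tau (nc_tracial E_prob). Qed.

Lemma tau_ge0 x : 0 <= tau (star x * x).
Proof. by have := nc_positive E_prob x; rewrite lecE => /andP[]. Qed.

Lemma E_pos_tau x : E (star x * x) = (tau (star x * x))%:C%C.
Proof. exact: ge0_realE (nc_positive E_prob x). Qed.

Lemma tau_faithful x : tau (star x * x) = 0 -> x = 0.
Proof.
by move=> h; apply: (nc_faithful E_prob); rewrite E_pos_tau h.
Qed.

(** With [h] scaled to norm 1, 1 - h is the square of a self-adjoint [s], and the difference of the
    two sides is a multiple of the trace of star (s x) (s x). *)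
Lemma tau_conj_le x h : star h = h ->
  tau (star x * h * x) <= opnorm h * tau (star x * x).
Proof.
move=> hs; have [h0|h0] := eqVneq (opnorm h) 0.
  by rewrite (opnorm0_eq0 _ h0) mulr0 mul0r tau0 opnorm0 mul0r.
have hp : 0 < opnorm h by rewrite lt_def h0 opnorm_ge0.
have [||s [ss s2 _ _]] := @sqrt_one_sub _ _ ((opnorm h)^-1 *:: h).
- by rewrite star_rscale hs.
- by rewrite opnorm_rscale ger0_norm ?invr_ge0 ?opnorm_ge0 // mulVf.
have := tau_ge0 (s * x).
have -> : star (s * x) * (s * x) = star x * (s * s) * x by rewrite starM ss !mulrA.
rewrite s2 mulrBr mulr1 mulrBl tauB rscaleAr rscaleAl tau_rscale subr_ge0.
by rewrite ler_pdivrMl.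
Qed.

(** Positivity of [E] at 1 + i x makes the imaginary part of i (E x - E (star x)) vanish, which
    compares the real parts. *)
Lemma tau_star x : tau (star x) = tau x.
Proof.
have H := nc_positive E_prob (1 + 'i%C *: x).
have H0 := nc_positive E_prob x; have H1 := nc_positive E_prob 1.
move: H; rewrite starD starZ star1 mulrDr !mulrDl !mulr1 !mul1r -scalerAl -scalerAr scalerA.
have -> : ('i%C : R[i])^* * 'i%C = 1.
  by rewrite complexiE conjCi mulNr -expr2 sqrCi opprK.
rewrite scale1r !linearD !linearZ /= (nc_unit E_prob).
move=> /ger0_Im; move/ger0_Im: H0; rewrite /tau.
case: (E (star x * x)) => a b /= ->; case: (E x) => c d /=; case: (E (star x)) => e f /=.
lra.
Qed.

Lemma E_sa_real h : star h = h -> E h = (tau h)%:C%C.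
Proof.
move=> hs; have := nc_positive E_prob (1 + h); have := nc_positive E_prob h.
rewrite starD star1 hs mulrDr !mulrDl !mulr1 !mul1r => /ger0_Im h0 /ger0_Im.
rewrite !linearD (nc_unit E_prob) /tau; move: h0.
case: (E (h * h)) => a b /= ->; case: (E h) => c d /= H; congr (_ +i* _)%C; lra.
Qed.

Lemma tau_sqr_le x : tau x ^+ 2 <= tau (star x * x).
Proof.
have := tau_ge0 (x - tau x *:: 1).
rewrite starB star_rscale star1 mulrBr !mulrBl rscaleAl rscaleAr rscaleAl rscaleAr.
rewrite !mulr1 mul1r !tauB !tau_rscale tau1 tau_star; lra.
Qed.

Lemma normr_tau_le x : `|tau x| <= opnorm x.
Proof.
have h : tau (star x * x) <= opnorm x ^+ 2.
  have := @tau_conj_le 1 (star x * x); rewrite star1 !mul1r !mulr1 tau1 mulr1.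
  by rewrite starM starK opnorm_starM; apply.
rewrite -(ler_pXn2r (n := 2)) ?nnegrE ?opnorm_ge0 //.
rewrite real_normK ?num_real //; exact: le_trans (tau_sqr_le x) h.
Qed.

(** Positivity is given only through the trace. Let m = |c| be the root of c^2 and [s] the root of
    [m]; the point is that n = |c| - c, twice the negative part, is zero. Since c n = - m n, the
    trace of n c n is minus that of star (s n) (s n), so s n = 0 by faithfulness, and then n^2 = 2 m
    n = 0. *)
Lemma positive_sqrt c :
  star c = c -> opnorm c <= 1 -> (forall x, 0 <= tau (star x * c * x)) ->
  exists s, [/\ star s = s, s * s = c & forall y, y * c = c * y -> y * s = s * y].
Proof.
move=> cs c1 cpos.
have [||m [ms m2 m1 mc]] := @sqrt_one_sub _ _ (1 - c * c).
- by rewrite starB star1 starM cs.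
- exact: opnorm_one_sub_sqr.
have {}m2 : m * m = c * c by rewrite m2 opprB addrCA subrr addr0.
have [||s [ss s2 _ sc]] := @sqrt_one_sub _ _ (1 - m).
- by rewrite starB star1 ms.
- exact: m1.
have {}s2 : s * s = m by rewrite s2 opprB addrCA subrr addr0.
have {}mc y : y * c = c * y -> y * m = m * y.
  move=> yc; apply: mc; rewrite mulrBr mulrBl mulr1 mul1r mulrA yc -mulrA yc mulrA //.
have {}sc y : y * c = c * y -> y * s = s * y.
  by move=> yc; apply: sc; rewrite mulrBr mulrBl mulr1 mul1r mc.
have cm : c * m = m * c by exact: mc.
have cs' : c * s = s * c by exact: sc.
pose n := m - c.
have ns : star n = n by rewrite starB ms cs.
have ms' : m * s = s * m by rewrite -s2 mulrA.
have nS : n * s = s * n by rewrite /n mulrBl mulrBr cs' ms'.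
have cn : c * n = - (m * n) by rewrite /n !mulrBr -m2 cm; ncring.
have sn0 : s * n = 0.
  apply: tau_faithful; apply/eqP; rewrite eq_le tau_ge0 andbT.
  rewrite starM ns ss -oppr_ge0 -tauN.
  have -> : - (n * s * (s * n)) = star n * c * n.
    by rewrite ns -[n * c * n]mulrA cn -s2; ncring.
  exact: cpos.
have nn : n * n = 0.
  rewrite {1}/n mulrBl cn -s2 -mulrA sn0 mulr0 oppr0 subrr //.
have n0 : n = 0.
  apply: opnorm0_eq0; apply/eqP; rewrite -sqrf_eq0 -opnorm_sa_sqr // nn opnorm0 //.
by exists s; split=> //; rewrite s2; apply/eqP; rewrite -subr_eq0 -/n n0.
Qed.

(** The hypothesis makes t^2 - b^2 positive for the trace, hence the square of a self-adjoint
    element commuting with [b]; [opnorm_unitary] concludes. *)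
Lemma opnorm_le_of_form b t : star b = b -> 0 <= t ->
  (forall x, tau (star x * (b * b) * x) <= t ^+ 2 * tau (star x * x)) ->
  opnorm b <= t.
Proof.
move=> bs t0 H.
pose c0 := (t ^+ 2) *:: 1 - b * b.
(* [positive_sqrt] asks for a contraction; the summand 1 keeps the scaling factor invertible even if
   [c0] is zero. *)
pose l := opnorm c0 + 1.
have l0 : 0 < l by rewrite /l ltr_wpDl ?opnorm_ge0.
have c0s : star c0 = c0 by rewrite /c0 starB star_rscale star1 starM bs.
have [|||s [ss s2 sc]] := @positive_sqrt (l^-1 *:: c0).
- by rewrite star_rscale c0s.
- rewrite opnorm_rscale ger0_norm ?invr_ge0 ?(ltW l0) // ler_pdivrMl // mulr1 /l; lra.
- move=> x; rewrite rscaleAr rscaleAl tau_rscale mulr_ge0 ?invr_ge0 ?(ltW l0) //.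
  rewrite /c0 mulrBr mulrBl tauB rscaleAr mulr1 rscaleAl tau_rscale subr_ge0.
  exact: H.
apply: (@opnorm_unitary b (Num.sqrt l *:: s)) => //.
- by rewrite star_rscale ss.
- rewrite rscaleAr rscaleAl; congr (_ *:: _); apply: sc.
  rewrite rscaleAr rscaleAl; congr (_ *:: _).
  by rewrite /c0 mulrBr mulrBl rscaleAl rscaleAr mul1r mulr1 mulrA.
- rewrite rscaleAl rscaleAr rscaleA -(expr2 (Num.sqrt l)) sqr_sqrtr ?(ltW l0) // s2.
  rewrite rscaleA divff ?gt_eqF //.
  by rewrite rscale1 /c0 addrCA subrr addr0.
Qed.

(** For fixed [x], the trace of star x b^(2k) x divided by t^(2k) is convex in k and, by traciality,
    bounded by [C] times the norm of x star x. A convex sequence bounded above cannot increase, and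
    its first step is the inequality asked for by [opnorm_le_of_form]. *)
Lemma opnorm_le_of_moments b t C : star b = b -> 0 < t ->
  (forall k, tau (b ^+ (2 * k)) <= C * t ^+ (2 * k)) -> opnorm b <= t.
Proof.
move=> bs t0 HC; apply: opnorm_le_of_form; rewrite ?(ltW t0) // => x.
pose q k := tau (star x * b ^+ (2 * k) * x).
(* Positivity of the trace at (t^2 - b^2) b^k x; after division by a power of [t] this is a second
   difference. *)
have qS k : 0 <= t ^+ 4 * q k - 2 * t ^+ 2 * q k.+1 + q k.+2.
  have := tau_ge0 ((t ^+ 2) *:: (b ^+ k * x) - b ^+ k.+2 * x).
  have e j l : star (b ^+ j * x) * (b ^+ l * x) = star x * b ^+ (j + l) * x.
    by rewrite starM starX bs exprD !mulrA.
  rewrite starB star_rscale mulrBr !mulrBl !rscaleAl !rscaleAr !e !tauB rscaleA.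
  rewrite !tau_rscale /q.
  have -> : (k + k = 2 * k)%N by lia.
  have -> : (k.+2 + k = 2 * k.+1)%N by lia.
  have -> : (k + k.+2 = 2 * k.+1)%N by lia.
  have -> : (k.+2 + k.+2 = 2 * k.+2)%N by lia.
  by move=> h; apply: le_trans h _; rewrite le_eqVlt; apply/orP; left; apply/eqP; ring.
pose r k := q k / t ^+ (2 * k).
have tX k : 0 < t ^+ k by rewrite exprn_gt0.
have rS k : r k.+1 - r k <= r k.+2 - r k.+1.
  have := qS k; have e : t ^+ (2 * k.+2) != 0 by rewrite gt_eqF.
  have -> : t ^+ 4 * q k - 2 * t ^+ 2 * q k.+1 + q k.+2 =
    t ^+ (2 * k.+2) * (r k.+2 - r k.+1 - (r k.+1 - r k)).
    rewrite /r.
    have -> : (2 * k.+2 = 4 + 2 * k)%N by lia.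
    have -> : (2 * k.+1 = 2 + 2 * k)%N by lia.
    rewrite !exprD; field; rewrite !expf_neq0 ?gt_eqF //.
  by rewrite pmulr_rge0 // subr_ge0.
have rB k : r k <= opnorm (x * star x) * C.
  rewrite /r ler_pdivrMr // -mulrA.
  apply: (@le_trans _ _ (opnorm (x * star x) * tau (b ^+ (2 * k)))).
    have -> : q k = tau (b ^+ k * (x * star x) * b ^+ k).
      by rewrite /q mul2n -addnn exprD mulrA -mulrA tauC !mulrA.
    have := @tau_conj_le (b ^+ k) (x * star x).
    by rewrite starM starK starX bs -exprD addnn -mul2n; apply.
  by apply: ler_wpM2l; rewrite ?opnorm_ge0.
have r10 : r 1%N <= r 0%N.
  rewrite leNgt; apply/negP => h.
  have inc k : r 1%N - r 0%N <= r k.+1 - r k.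
    by elim: k => // k IH; apply: le_trans IH (rS k).
  have lin k : r 0%N + (r 1%N - r 0%N) *+ k <= r k.
    elim: k => [|k IH]; first by rewrite mulr0n addr0.
    rewrite mulrSr; have := inc k; lra.
  have d0 : 0 < r 1%N - r 0%N by lra.
  have := archi_boundP (normr_ge0 ((opnorm (x * star x) * C - r 0%N) / (r 1%N - r 0%N))).
  set N := Num.bound _ => hN.
  have := lin N; have := rB N; move: (le_lt_trans (ler_norm _) hN).
  rewrite ltr_pdivrMr // -mulr_natl; lra.
move: r10; rewrite /r /q muln1 muln0 !expr0 mulr1 divr1 expr2 ler_pdivrMr //.
by rewrite mulrC -expr2.
Qed.

End StateFacts.

(** * Freeness *)

Section Freeness.
Variables (R : realType) (A : cstarAlgType R) (E : {scalar A}).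
Hypothesis E_prob : nc_probability E.
Variables (I : eqType) (B : I -> set A).
Hypothesis B_star : forall i, star_subalgebra (B i).
Hypothesis B_free : free_subalgebras E B.
Implicit Types (x y z d : A) (l : seq (I * A)) (J : pred I) (i k : I).

Lemma subalg_one i : B i 1.
Proof. by have [[]] := B_star i; rewrite in_setE. Qed.

Lemma subalg_lin i (c : R[i]) x y : B i x -> B i y -> B i (c *: x + y).
Proof.
move=> bx b_y; have [[_ H _] _] := B_star i.
by have := H c x y; rewrite !in_setE; apply.
Qed.

Lemma subalg_mul i x y : B i x -> B i y -> B i (x * y).
Proof.
move=> bx b_y; have [[_ _ H] _] := B_star i.
by have := H x y; rewrite !in_setE; apply.
Qed.

Lemma subalg_star i x : B i x -> B i (star x).
Proof.
move=> bx; have [_ H] := B_star i.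
by have := H x; rewrite !in_setE; apply.
Qed.

Lemma subalg_scale i (c : R[i]) x : B i x -> B i (c *: x).
Proof.
move=> bx; have b0 : B i 0.
  by have := @subalg_lin i (-1) 1 1 (subalg_one i) (subalg_one i); rewrite scaleN1r addNr.
by have := subalg_lin c bx b0; rewrite addr0.
Qed.

Lemma subalg_center i x : B i x -> B i (x - E x *: 1).
Proof.
by move=> bx; rewrite addrC -scaleNr; apply: subalg_lin => //; apply: subalg_one.
Qed.

Lemma E_center x : E (x - E x *: 1) = 0.
Proof. by rewrite linearB linearZ /= (nc_unit E_prob) mulr1 subrr. Qed.

Definition alternating l :=
  (forall p, p \in l -> B p.1 p.2 /\ E p.2 = 0) /\
  sorted (fun p q : I * A => p.1 != q.1) l.

Definition word_prod l : A := \prod_(p <- l) p.2.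

Lemma word_prod_cons p l : word_prod (p :: l) = p.2 * word_prod l.
Proof. exact: big_cons. Qed.

Lemma word_prod_cat l1 l2 : word_prod (l1 ++ l2) = word_prod l1 * word_prod l2.
Proof. exact: big_cat. Qed.

Lemma E_alternating_cyclic p l : alternating (p :: l) ->
  (last p l).1 != p.1 -> E (word_prod (p :: l)) = 0.
Proof.
move=> [pl srt] lst.
pose w (i : 'I_(size l).+1) := nth p (p :: l) i.
have -> : word_prod (p :: l) = \prod_(i < (size l).+1) (w i).2.
  by rewrite /word_prod (big_nth p) big_mkord.
apply: (B_free (k := fun u => (w u).1)) => [u|u|u v uv|].
- by rewrite in_setE; apply: (pl _ _).1; apply: mem_nth.
- by apply: (pl _ _).2; apply: mem_nth.
- rewrite /w uv; apply: (sortedP p srt); rewrite -uv; exact: ltn_ord.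
- by rewrite /w /= (last_nth p) in lst *.
Qed.

(** The assumed freeness covers only words whose two ends lie in different algebras. In the other
    case traciality brings the last letter next to the first, in the same algebra. Their product is
    a centred letter plus a scalar, which leaves a cyclically alternating word and a shorter
    alternating one. *)
Lemma E_alternating l : alternating l -> l != [::] -> E (word_prod l) = 0.
Proof.
have [n] := ubnP (size l); elim: n l => // n IH [//|p l] sz alt _.
case/lastP: l sz alt => [|l q] sz alt.
  by rewrite /word_prod big_seq1; apply: (alt.1 _ _).2; rewrite inE.
have [e|ne] := eqVneq q.1 p.1; last by apply: E_alternating_cyclic; rewrite ?last_rcons.
have [altp srt] := alt.
have [pB _] := altp p (mem_head _ _).
have [|qB _] := altp q; first by rewrite inE mem_rcons mem_head orbT.
move: srt; rewrite /= rcons_path => /andP[pth lq].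
have altl : alternating l.
  split; last exact: path_sorted pth.
  by move=> r rl; apply: altp; rewrite inE mem_rcons inE rl !orbT.
have l0 : l != [::].
  by apply/negP => /eqP l0; move: lq; rewrite l0 /= e eqxx.
pose d := q.2 * p.2 - E (q.2 * p.2) *: 1.
have qp : q.2 * p.2 = d + E (q.2 * p.2) *: 1 by rewrite /d subrK.
have dB : B p.1 d by apply: subalg_center; apply: subalg_mul; [rewrite -e|].
rewrite word_prod_cons -cats1 word_prod_cat [word_prod [:: q]]big_seq1.
rewrite mulrA (nc_tracial E_prob) mulrA qp mulrDl linearD /=.
rewrite -scalerAl mul1r linearZ /= IH // ?mulr0 ?addr0; last first.
  by move: sz; rewrite /= size_rcons; lia.
case: l l0 altl pth lq {alt altp sz} => // r l _ [alt srt] pth lq.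
rewrite -[d]/((p.1, d).2) -word_prod_cons; apply: E_alternating_cyclic.
  split=> [s|]; last exact: pth.
  by rewrite inE => /predU1P[-> /=|/alt //]; rewrite E_center.
by move: lq; rewrite /= e.
Qed.

Inductive word_span (P : seq (I * A) -> Prop) : A -> Prop :=
| word_span0 : word_span P 0
| word_spanD (c : R[i]) l x : P l -> word_span P x ->
    word_span P (c *: word_prod l + x).

Lemma word_span_word (P : seq (I * A) -> Prop) l : P l -> word_span P (word_prod l).
Proof.
move=> Pl; have := word_spanD 1 Pl (word_span0 P); by rewrite scale1r addr0.
Qed.

Lemma word_span_lin P (c : R[i]) x y :
  word_span P x -> word_span P y -> word_span P (c *: x + y).
Proof.
move=> Px Py; elim: Px => [|c' l {}x Pl _ IH]; first by rewrite scaler0 add0r.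
by rewrite scalerDr scalerA -addrA; apply: word_spanD.
Qed.

Lemma word_span_map (P Q : seq (I * A) -> Prop) (f : A -> A) x :
  (forall (c : R[i]) y z, f (c *: y + z) = c *: f y + f z) ->
  (forall l, P l -> word_span Q (f (word_prod l))) ->
  word_span P x -> word_span Q (f x).
Proof.
move=> lf H; elim=> [|c l {}x Pl _ IH].
  have -> : f 0 = 0 by have := lf (-1) 0 0; rewrite scaler0 add0r scaleN1r addNr.
  exact: word_span0.
by rewrite lf; apply: word_span_lin => //; apply: H.
Qed.

Definition word_in J l := alternating l /\ all (fun p => J p.1) l.

(** The new letter is merged with the first letter of the word when both lie in the same algebra,
    and prefixed otherwise; centring the result splits off a scalar multiple of a word that still
    alternates. *)
Lemma word_span_mulB J k c x : J k -> B k c ->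
  word_span (word_in J) x -> word_span (word_in J) (c * x).
Proof.
move=> Jk cB; apply: (@word_span_map _ _ ( *%R c)) => [r y z|l [alt lJ]].
  by rewrite mulrDr scalerAr.
case: l alt lJ => [|[i d] l] [alt srt] lJ.
  rewrite [word_prod [::]]big_nil mulr1.
  have -> : c = E c *: word_prod [::] + word_prod [:: (k, c - E c *: 1)].
    by rewrite /word_prod big_nil big_seq1 /= addrCA subrr addr0.
  apply: word_span_lin; apply: word_span_word; split => //=; rewrite ?Jk //.
  by split=> // p; rewrite inE => /eqP -> /=; rewrite E_center; split=> //; apply: subalg_center.
have altl : alternating l.
  by split; [move=> p pl; apply: alt; rewrite inE pl orbT | exact: path_sorted srt].
have [dB dE] := alt _ (mem_head _ _).
have [e|ne] := eqVneq k i.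
  subst k; rewrite word_prod_cons mulrA /=.
  pose d' := c * d - E (c * d) *: 1.
  have -> : c * d * word_prod l = E (c * d) *: word_prod l + word_prod ((i, d') :: l).
    by rewrite word_prod_cons /= mulrBl -scalerAl mul1r addrCA subrr addr0.
  apply: word_span_lin; apply: word_span_word; split => //.
    by case/andP: lJ.
  split; last by move: srt; case: (l).
  move=> p; rewrite inE => /predU1P[-> /=|pl].
    by rewrite E_center; split=> //; apply/subalg_center/subalg_mul.
  by apply: alt; rewrite inE pl orbT.
pose c' := c - E c *: 1.
have -> : c * word_prod ((i, d) :: l) =
    E c *: word_prod ((i, d) :: l) + word_prod [:: (k, c'), (i, d) & l].
  by rewrite (word_prod_cons (k, c')) /= /c' mulrBl -scalerAl mul1r addrCA subrr addr0.
apply: word_span_lin; apply: word_span_word; split => //; last by rewrite /= Jk.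
split; last by rewrite /= ne.
move=> p; rewrite inE => /predU1P[-> /=|pl]; last exact: alt.
by rewrite E_center; split=> //; apply: subalg_center.
Qed.

(* Left multipliers of the span of the words with letters in [J]: a subalgebra
   containing the [B k], [k] in [J], and contained in that span. *)
Definition join_alg J : set A :=
  [set y | forall z, word_span (word_in J) z -> word_span (word_in J) (y * z)]%classic.

Lemma join_alg_sub J k c : J k -> B k c -> join_alg J c.
Proof. by move=> Jk Bc z; apply: word_span_mulB Bc. Qed.

Lemma join_alg1 J : join_alg J 1.
Proof. by move=> z; rewrite mul1r. Qed.

Lemma join_alg_lin J (c : R[i]) x y :
  join_alg J x -> join_alg J y -> join_alg J (c *: x + y).
Proof.
by move=> Jx Jy z Hz; rewrite mulrDl -scalerAl; apply: word_span_lin; [apply: Jx | apply: Jy].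
Qed.

Lemma join_alg_mul J x y : join_alg J x -> join_alg J y -> join_alg J (x * y).
Proof. by move=> Jx Jy z Hz; rewrite -mulrA; apply/Jx/Jy. Qed.

(** Nonempty alternating words are killed by [E], so the coefficient of the empty word is E y. *)
Lemma join_alg_span J y : join_alg J y -> E y = 0 ->
  word_span (fun l => word_in J l /\ l != [::]) y.
Proof.
move=> Jy Ey0.
have : word_span (word_in J) y.
  rewrite -[y]mulr1; apply: Jy.
  have -> : (1 : A) = word_prod [::] by rewrite /word_prod big_nil.
  by apply: word_span_word.
have H x : word_span (word_in J) x -> exists c : R[i], exists2 x',
    word_span (fun l => word_in J l /\ l != [::]) x' & x = c *: 1 + x'.
  elim=> [|c l {}x Pl _ [c' [x' Hx' ->]]].
    by exists 0, 0; [exact: word_span0 | rewrite scale0r addr0].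
  have [l0|l0] := eqVneq l [::].
    by exists (c + c'), x' => //; rewrite l0 /word_prod big_nil addrA scalerDl.
  exists c', (c *: word_prod l + x'); first exact: word_spanD.
  by rewrite addrCA.
have E0 x : word_span (fun l => word_in J l /\ l != [::]) x -> E x = 0.
  elim=> [|c l {}x [[alt _] l0] _ IH]; first by rewrite linear0.
  by rewrite linearP /= IH E_alternating // mulr0 addr0.
move=> /H [c [x' Hx' e]].
suff c0 : c = 0 by rewrite e c0 scale0r add0r.
by move: Ey0; rewrite e linearP /= (E0 _ Hx') addr0 (nc_unit E_prob) mulr1.
Qed.

(** As [k] is outside [J], the letter [x] can stand between words with letters in [J], so y (x y)^j
    is a combination of alternating words that begin in [J]; in particular they are nonempty. The
    factor [d] need not be centred: its scalar part leaves such a word, its centred part adds one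
    letter in front. *)
Lemma free_join_vanish J k d x y j : ~~ J k -> B k d -> B k x -> join_alg J y ->
  E x = 0 -> E y = 0 -> E (d * y * (x * y) ^+ j) = 0.
Proof.
move=> Jk dB xB yJ Ex0 Ey0.
pose P l := alternating l /\ match l with p :: _ => J p.1 | [::] => False end.
have sy := join_alg_span yJ Ey0.
have sP : word_span P (y * (x * y) ^+ j).
  elim: j => [|j IH].
    rewrite expr0 mulr1; move: sy; apply: (@word_span_map _ _ id) => // l [[alt lJ] l0].
    apply: word_span_word; split=> //; by case: l l0 lJ {alt} => //= p l _ /andP[].
  rewrite exprS -mulrA mulrA; set t := y * (x * y) ^+ j in IH *.
  move: sy; rewrite -mulrA; apply: (@word_span_map _ _ (fun y => y * (x * t))).
    by move=> c u v; rewrite mulrDl scalerAl.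
  move=> l [[[alt srt] lJ] l0]; rewrite mulrA.
  move: IH; apply: word_span_map => [c u v|l' [[alt' srt'] hd']].
    by rewrite mulrDr scalerAr.
  have -> : word_prod l * x * word_prod l' = word_prod (l ++ (k, x) :: l').
    by rewrite word_prod_cat word_prod_cons mulrA.
  apply: word_span_word; split; last by case: l l0 lJ {alt srt} => //= p l _ /andP[].
  split.
    move=> p; rewrite mem_cat inE => /orP[/alt //|/predU1P[->|/alt' //]] //.
  case: l l0 srt lJ {alt} => //= p l _ srt lJ.
  rewrite cat_path srt /=; apply/andP; split.
    have : J (last p l).1.
      exact: (allP (lJ : all (fun p => J p.1) (p :: l)) _ (mem_last p l)).
    by apply: contraTneq => ->.
  by case: l' hd' srt' {alt'} => //= q l' Jq ->; rewrite andbT; apply: contraNneq Jk => ->.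
pose d' := d - E d *: 1.
have -> : d = d' + E d *: 1 by rewrite /d' subrK.
rewrite -mulrA mulrDl -scalerAl mul1r linearD linearZ /=.
move: sP; set t := y * _; elim=> [|c l {t} t [[alt srt] hd] _ IH].
  by rewrite !(mulr0, linear0) addr0.
rewrite mulrDr !linearD linearZ /= (mulrDr (E d)) addrACA IH addr0 -scalerAr linearZ /=.
have -> : d' * word_prod l = word_prod ((k, d') :: l) by rewrite word_prod_cons.
rewrite !E_alternating ?mulr0 ?addr0 //.
- by case: l hd {alt srt}.
- split; last first.
    case: l hd srt {alt} => //= q l Jq ->; rewrite andbT.
    by apply: contraNneq Jk => ->.
  move=> p; rewrite inE => /predU1P[->|/alt //] /=; rewrite E_center; split=> //.
  exact: subalg_center.
Qed.

End Freeness.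

(** * The resolvent of a product of two free elements *)

(** Scalar multiples are not ring expressions, so they are generalised to atoms before
    normalising. *)
Ltac ncring_atoms :=
  repeat match goal with
  |- context [rscale ?r ?z] => move: (rscale r z) => ? end; ncring.

Section Resolvent.
Variables (R : realType) (A : cstarAlgType R).
Implicit Types (a b x y z : A) (K : nat).

(** Plays the part of (1 - x)^-1, with defect x^K. *)
Definition geom K x : A := \sum_(k < K) x ^+ k.

Lemma geom_mull K x : (1 - x) * geom K x = 1 - x ^+ K.
Proof. by rewrite -[RHS]opprB subrX1 -mulNr opprB. Qed.

Lemma geom_comm K x : x * geom K x = geom K x * x.
Proof.
by rewrite /geom mulr_sumr mulr_suml; apply: eq_bigr => i _; rewrite -exprS -exprSr.
Qed.

Lemma geom_mulr K x : geom K x * (1 - x) = 1 - x ^+ K.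
Proof. by rewrite -geom_mull mulrBr mulrBl mulr1 mul1r geom_comm. Qed.

(** The relation l u = v cancels the terms linear in [x] and in [y], which is the origin of the
    factor (1 + u) / u; then v - u = 1 reduces the constant term v^2 - l u^2 to v. *)
Lemma resolvent_scalars (u v l : R) x y : v - u = 1 -> l * u = v ->
  (v *:: 1 + x) * (v *:: 1 + y) - l *:: ((u *:: 1 + x) * (u *:: 1 + y)) =
  v *:: 1 - (l - 1) *:: (x * y).
Proof.
move=> vu lu; rewrite !(mulrDl, mulrDr, rscaleAl, rscaleAr, mul1r, mulr1).
rewrite !(rscaleD, rscaleA) mulrA lu.
have -> : v * v = v + v * u by rewrite -[X in _ = X + _]mulr1 -vu; ring.
by rewrite !rscaleDl rscaleNl rscale1; ncring_atoms.
Qed.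

Variables (K : nat) (a b : A) (u delta : R).
Hypotheses (u0 : u != 0) (u1 : 1 + u != 0).

Let lambda := (1 + u) / u.
Let f := geom K a.
Let g := geom K b.
Let x := f - (1 + u) *:: 1.
Let y := g - (1 + u + delta) *:: 1.
Let p := lambda *:: (a * b).
Let q := (u * (1 + u))^-1 *:: (x * y).
Let T := geom K q.

(* [u] and [delta] stand for E f - 1 and E g - E f.  Each term of the errors has
   a factor [delta] or a [K]-th power coming from a truncated geometric sum. *)
Definition res_err1 : A :=
  f * (delta *:: 1) -
  lambda *:: ((f - 1) * (delta *:: 1) + a ^+ K * (b * g) + (f - 1) * b ^+ K).
Definition res_err2 : A := res_err1 * T - (1 + u) *:: q ^+ K.
Definition res_err3 : A :=
  a ^+ K * (1 - p) * (g * T * f) - (1 + u) *:: a ^+ K + (1 - a) * res_err2 * f.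
Definition res_err : A := geom K p * res_err3 + p ^+ K * (g * T * f).

(** Up to K-th powers f a = f - 1 and b g = g - 1, so the left side is f g - lambda (f - 1) (g - 1).
    Subtracting delta from [g] gives both factors the same mean 1 + u, the situation of
    [resolvent_scalars]. *)
Lemma resolvent_step1 : f * (1 - p) * g = (1 + u) *:: (1 - q) + res_err1.
Proof.
have fa : f * a = (f - 1) + a ^+ K.
  have := geom_mulr K a; rewrite -/f mulrBr mulr1 => e.
  by rewrite -[f * a](subKr f) e; ncring.
have bg : b * g = (g - 1) + b ^+ K.
  have := geom_mull K b; rewrite -/g mulrBl mul1r => e.
  by rewrite -[b * g](subKr g) e; ncring.
have e1 : f * (1 - p) * g = f * g - lambda *:: ((f * a) * (b * g)).
  by rewrite /p mulrBr mulr1 mulrBl rscaleAr rscaleAl !mulrA.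
have ef : f = (1 + u) *:: 1 + x by rewrite /x addrCA subrr addr0.
have ey : g - delta *:: 1 = (1 + u) *:: 1 + y.
  by rewrite /y [(_ + delta) *:: _]rscaleDl; ncring.
have e2 : f * (g - delta *:: 1) - lambda *:: ((f - 1) * (g - 1 - delta *:: 1)) =
    (1 + u) *:: (1 - q).
  have -> : f - 1 = u *:: 1 + x by rewrite ef rscaleDl rscale1; ncring.
  have -> : g - 1 - delta *:: 1 = u *:: 1 + y.
    by rewrite addrAC ey rscaleDl rscale1; ncring.
  have vu : 1 + u - u = 1 by rewrite addrK.
  have lu : lambda * u = 1 + u by rewrite /lambda divfK.
  rewrite ey ef (resolvent_scalars _ _ vu lu).
  rewrite rscaleB /q rscaleA; congr (_ - _ *:: _).
  by rewrite /lambda; field; rewrite u0 u1.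
have e3 : f * a * (b * g) = (f - 1) * (g - 1 - delta *:: 1) +
    ((f - 1) * (delta *:: 1) + a ^+ K * (b * g) + (f - 1) * b ^+ K).
  rewrite fa mulrDl {1}bg; move: (a ^+ K) (b ^+ K) (b * g) (delta *:: 1) => t1 t2 t3 t4.
  by ncring.
rewrite -e2 e1 e3 rscaleD /res_err1 -/f -/g.
by ncring_atoms.
Qed.

Lemma resolvent_step2 : f * (1 - p) * (g * T) = (1 + u) *:: 1 + res_err2.
Proof.
rewrite mulrA resolvent_step1 mulrDl rscaleAl geom_mull rscaleB /res_err2.
by ncring_atoms.
Qed.

(** Multiplying the previous identity by 1 - a on the left and by [f] on the right removes the
    leading [f], up to a^K, and puts it at the end. *)
Lemma resolvent_step3 : (1 - p) * (g * T * f) = (1 + u) *:: 1 + res_err3.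
Proof.
have e : (1 - a) * (f * (1 - p) * (g * T)) * f = (1 - a ^+ K) * ((1 - p) * (g * T * f)).
  by rewrite -(geom_mull K a) !mulrA.
have e' : (1 - a) * ((1 + u) *:: 1) * f = (1 + u) *:: 1 - (1 + u) *:: a ^+ K.
  by rewrite rscaleAr rscaleAl mulr1 geom_mull rscaleB.
rewrite resolvent_step2 mulrDr mulrDl e' in e.
rewrite /res_err3 -[a ^+ K * (1 - p) * _]mulrA.
move: e; set W := (1 - p) * _ => e.
transitivity ((1 - a ^+ K) * W + a ^+ K * W); first by rewrite -mulrDl subrK mul1r.
by rewrite -e; move: (a ^+ K * W) => ?; ncring_atoms.
Qed.

Lemma resolvent_product : g * T * f = (1 + u) *:: geom K p + res_err.
Proof.
have e : geom K p * ((1 - p) * (g * T * f)) = (1 - p ^+ K) * (g * T * f).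
  by rewrite mulrA geom_mulr.
rewrite resolvent_step3 mulrDr rscaleAr mulr1 in e.
rewrite /res_err addrA e; move: (p ^+ K) (g * T * f) => t1 t2; ncring.
Qed.

End Resolvent.

(** * Orders of vanishing at zero, for real functions and for functions into the algebra *)

Section AsymptoticsAtZero.
Variable R : realType.
Implicit Types (f g : R -> R) (k l : nat).

(* [f = O(s^k)] as [s] tends to 0 from the right. *)
Definition Ole f k : Prop :=
  exists C e : R, [/\ 0 < C, 0 < e & forall s, 0 < s < e -> f s <= C * s ^+ k].

Lemma Ole_dom f g k : (forall s, 0 < s -> f s <= g s) -> Ole g k -> Ole f k.
Proof.
move=> fg [C [e [C0 e0 H]]]; exists C, e; split=> // s /[dup] /andP[s0 _] /H.
exact/le_trans/fg.
Qed.

Lemma Ole_near f g k (e : R) : 0 < e -> (forall s, 0 < s < e -> f s <= g s) ->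
  Ole g k -> Ole f k.
Proof.
move=> e0 fg [C [e' [C0 e'0 H]]]; exists C, (Num.min e e'); split=> //.
  by rewrite lt_min e0.
move=> s; rewrite lt_min => /and3P[s0 se se'].
by apply: le_trans (fg s _) (H s _); rewrite s0.
Qed.

Lemma Ole_cst (c : R) : Ole (fun=> c) 0.
Proof.
exists (`|c| + 1), 1; split=> [|//|s _]; first by rewrite ltr_wpDl.
by rewrite expr0 mulr1; apply: le_trans (ler_norm c) _; rewrite lerDl.
Qed.

Lemma Ole_weak f k l : (l <= k)%N -> Ole f k -> Ole f l.
Proof.
move=> lk [C [e [C0 e0 H]]]; exists C, (Num.min e 1); split=> //.
  by rewrite lt_min e0 ltr01.
move=> s; rewrite lt_min => /and3P[s0 se s1]; apply: le_trans (H s _) _.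
  by rewrite s0.
by rewrite ler_wpM2l ?(ltW C0) // ler_wiXn2l // ltW.
Qed.

Lemma Ole_add f g k : Ole f k -> Ole g k -> Ole (fun s => f s + g s) k.
Proof.
move=> [C [e [C0 e0 H]]] [C' [e' [C'0 e'0 H']]].
exists (C + C'), (Num.min e e'); split; first exact: addr_gt0.
  by rewrite lt_min e0.
move=> s; rewrite lt_min => /and3P[s0 se se'].
by rewrite mulrDl lerD // ?H ?H' // s0.
Qed.

Lemma Ole_mul f g k l : (forall s, 0 <= f s) -> (forall s, 0 <= g s) ->
  Ole f k -> Ole g l -> Ole (fun s => f s * g s) (k + l).
Proof.
move=> f0 g0 [C [e [C0 e0 H]]] [C' [e' [C'0 e'0 H']]].
exists (C * C'), (Num.min e e'); split; first exact: mulr_gt0.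
  by rewrite lt_min e0.
move=> s; rewrite lt_min => /and3P[s0 se se'].
by rewrite exprD mulrACA ler_pM // ?H ?H' // s0.
Qed.

Lemma Ole_shift f k : (forall s, 0 <= f s) -> Ole (fun s => f s * s) k.+1 -> Ole f k.
Proof.
move=> f0 [C [e [C0 e0 H]]]; exists C, e; split=> // s /[dup] /andP[s0 _] /H.
by rewrite exprSr mulrA ler_pM2r.
Qed.

Definition Osc f k : Prop := Ole (fun s => `|f s|) k.

Lemma Osc_add f g k : Osc f k -> Osc g k -> Osc (fun s => f s + g s) k.
Proof.
by move=> Hf Hg; apply: Ole_dom (Ole_add Hf Hg) => s _; apply: ler_normD.
Qed.

Lemma Osc_opp f k : Osc f k -> Osc (fun s => - f s) k.
Proof. by apply: Ole_dom => s _; rewrite normrN. Qed.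

Lemma Osc_sub f g k : Osc f k -> Osc g k -> Osc (fun s => f s - g s) k.
Proof. by move=> Hf Hg; apply/Osc_add/Osc_opp. Qed.

Lemma Osc_mul f g k l : Osc f k -> Osc g l -> Osc (fun s => f s * g s) (k + l).
Proof.
by move=> Hf Hg; apply: Ole_dom (Ole_mul _ _ Hf Hg) => s *; rewrite ?normrM.
Qed.

Lemma Osc_eq f g k : (forall s, 0 < s -> f s = g s) -> Osc g k -> Osc f k.
Proof. by move=> e; apply: Ole_dom => s s0; rewrite e. Qed.

Lemma Osc_near f g k (e : R) : 0 < e -> (forall s, 0 < s < e -> f s = g s) ->
  Osc g k -> Osc f k.
Proof. by move=> e0 H; apply: Ole_near e0 _ => s /H ->. Qed.

Lemma Osc_cst (c : R) : Osc (fun=> c) 0.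
Proof. exact: Ole_cst. Qed.

Lemma Osc_id : Osc id 1.
Proof.
by exists 1, 1; split=> // s /andP[s0 _]; rewrite mul1r expr1 gtr0_norm.
Qed.

Lemma Osc_exp f k l : Osc f k -> Osc (fun s => f s ^+ l) (l * k).
Proof.
move=> H; elim: l => [|l IH]; first exact: (Osc_cst 1).
by apply: Osc_eq (Osc_mul H IH) => s _; rewrite exprS.
Qed.

(** [f] may have a simple pole at 0, as (1 + u) / u has; the pole costs one order. *)
Lemma Osc_shift f g k : Osc (fun s => f s * s) 0 -> Osc g k.+1 -> Osc (fun s => f s * g s) k.
Proof.
move=> Hf Hg; apply: Ole_shift => //; apply: Ole_dom (Osc_mul Hf Hg) => s s0.
by rewrite mulrAC (normrM (f s * g s)) (gtr0_norm s0).
Qed.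

Variable A : cstarAlgType R.
Implicit Types (F G : R -> A).

Definition Oop F k : Prop := Ole (fun s => opnorm (F s)) k.

Lemma Oop_add F G k : Oop F k -> Oop G k -> Oop (fun s => F s + G s) k.
Proof.
by move=> Hf Hg; apply: Ole_dom (Ole_add Hf Hg) => s _; apply: opnormD_le.
Qed.

Lemma Oop_sub F G k : Oop F k -> Oop G k -> Oop (fun s => F s - G s) k.
Proof.
by move=> Hf Hg; apply: Ole_dom (Ole_add Hf Hg) => s _; apply: opnormB_le.
Qed.

Lemma Oop_mul F G k l : Oop F k -> Oop G l -> Oop (fun s => F s * G s) (k + l).
Proof.
move=> Hf Hg; apply: Ole_dom (Ole_mul _ _ Hf Hg) => s *; first exact: opnormM_le.
all: exact: opnorm_ge0.
Qed.

Lemma Oop_scale f F k l : Osc f k -> Oop F l -> Oop (fun s => f s *:: F s) (k + l).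
Proof.
move=> Hf Hg; apply: Ole_dom (Ole_mul _ _ Hf Hg) => s *; rewrite ?opnorm_rscale //.
exact: opnorm_ge0.
Qed.

Lemma Oop_shift f F k : Osc (fun s => f s * s) 0 -> Oop F k.+1 ->
  Oop (fun s => f s *:: F s) k.
Proof.
move=> Hf Hg; apply: Ole_shift => [s|]; first exact: opnorm_ge0.
apply: Ole_dom (Ole_mul _ _ Hf Hg) => s; rewrite ?opnorm_ge0 // => s0.
by rewrite opnorm_rscale normrM (gtr0_norm s0) mulrAC.
Qed.

Lemma Oop_cst (x : A) : Oop (fun=> x) 0.
Proof. exact: Ole_cst. Qed.

Lemma Oop_eq F G k : (forall s, 0 < s -> F s = G s) -> Oop G k -> Oop F k.
Proof. by move=> e; apply: Ole_dom => s s0; rewrite e. Qed.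

Lemma Oop_exp F k l : Oop F k -> Oop (fun s => F s ^+ l) (l * k).
Proof.
move=> H; elim: l => [|l IH]; first exact: (Oop_cst 1).
by apply: Oop_eq (Oop_mul H IH) => s _; rewrite exprS.
Qed.

Lemma Oop_geom F K : Oop F 0 -> Oop (fun s => geom K (F s)) 0.
Proof.
move=> H; elim: K => [|K IH].
  by apply: Oop_eq (Oop_cst 0) => s _; rewrite /geom big_ord0.
apply: Oop_eq (Oop_add IH (Ole_weak (leq0n _) (Oop_exp K H))) => s _.
by rewrite /geom big_ord_recr.
Qed.

Lemma geomS (x : A) K : geom K.+1 x = 1 + x * geom K x.
Proof.
rewrite /geom big_ord_recl expr0 mulr_sumr; congr (_ + _).
by apply: eq_bigr => i _; rewrite exprS.
Qed.

Lemma Oop_geom_sub1 F K : Oop F 1 -> Oop (fun s => geom K.+1 (F s) - 1) 1.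
Proof.
move=> H; apply: Oop_eq (Oop_mul H (Oop_geom K (Ole_weak (leq0n _) H))) => s _.
by rewrite geomS addrC addKr.
Qed.

Variable E : {scalar A}.
Hypothesis E_prob : nc_probability E.

Lemma Osc_tau F k : Oop F k -> Osc (fun s => tau E (F s)) k.
Proof. by apply: Ole_dom => s _; apply: normr_tau_le. Qed.

End AsymptoticsAtZero.

(** * Moments of a product of two free elements *)

Section FreeProduct.
Variables (R : realType) (A : cstarAlgType R) (E : {scalar A}).
Hypothesis E_prob : nc_probability E.
Variables (SA SB : set A).
Hypotheses (SA1 : SA 1) (SAM : forall x y, SA x -> SA y -> SA (x * y))
  (SAL : forall (c : R[i]) x y, SA x -> SA y -> SA (c *: x + y)).
Hypotheses (SB1 : SB 1) (SBM : forall x y, SB x -> SB y -> SB (x * y))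
  (SBL : forall (c : R[i]) x y, SB x -> SB y -> SB (c *: x + y)).
(** In the application [SA] is the algebra of one variable and [SB] the join of the algebras of the
    preceding ones; [free_join_vanish] then supplies this form of freeness. *)
Hypothesis vanish : forall d x y j, SA d -> SA x -> SB y -> E x = 0 -> E y = 0 ->
  E (d * y * (x * y) ^+ j) = 0.

(** Under the trace b (x y)^j a becomes a b (x y)^j, with b = y + v. The part with [y] vanishes by
    freeness, and so does v a (x y)^j for j > 0, with a x in the role of [d]. Only j = 0
    contributes. *)
Lemma E_geom_alternating K (a b : A) (u v r : R) :
  SA a -> SB b ->
  let x := a - u *:: 1 in let y := b - v *:: 1 in
  E a = u%:C%C -> E b = v%:C%C ->
  tau E (b * geom K.+1 (r *:: (x * y)) * a) = u * v.
Proof.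
move=> aA bB x y Ea Eb.
have xA : SA x by rewrite /x addrC /rscale -scaleNr; apply: SAL.
have yB : SB y by rewrite /y addrC /rscale -scaleNr; apply: SBL.
have Ex : E x = 0 by rewrite /x linearB linearZ /= (nc_unit E_prob) mulr1 Ea subrr.
have Ey : E y = 0 by rewrite /y linearB linearZ /= (nc_unit E_prob) mulr1 Eb subrr.
have eb : b = y + v *:: 1 by rewrite /y subrK.
have k0 j : tau E (b * (x * y) ^+ j * a) = if j == 0%N then u * v else 0.
  rewrite tauC // mulrA {1}eb mulrDr rscaleAr mulr1 mulrDl tauD rscaleAl tau_rscale.
  rewrite {1}/tau vanish //= add0r.
  case: j => [|j]; first by rewrite expr0 mulr1 /tau Ea mulrC.
  rewrite exprS !mulrA /tau vanish ?mulr0 //; exact: SAM.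
rewrite /geom mulr_sumr mulr_suml tau_sum.
rewrite (eq_bigr (fun k : 'I_K.+1 => r ^+ k * (if k == 0%N :> nat then u * v else 0))).
  rewrite big_ord_recl expr0 mul1r big1 ?addr0 // => i _; exact: mulr0.
by move=> k _; rewrite rscaleXn rscaleAr rscaleAl tau_rscale k0.
Qed.

(** With x = a - 1 and y = b - 1, the square of a b is a^2 + a^2 y + a y a + a y^2 + a y x y.
    Freeness kills all terms except a^2 and a y^2, and the latter has the trace of y^2. *)
Lemma tau_free_mul (a b : A) : SA a -> SB b -> E a = 1 -> E b = 1 ->
  tau E (a * b) = 1 /\
  tau E ((a * b) ^+ 2) = tau E (a ^+ 2) + tau E (b ^+ 2) - 1.
Proof.
move=> aA bB Ea Eb.
have [[x xE] [y yE]] : (exists x, x = a - 1) /\ (exists y, y = b - 1).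
  by split; [exists (a - 1) | exists (b - 1)].
have subA r : SA r -> forall c : R[i], SA (r - c *: 1).
  by move=> rA c; rewrite addrC -scaleNr; apply: SAL.
have subB r : SB r -> forall c : R[i], SB (r - c *: 1).
  by move=> rB c; rewrite addrC -scaleNr; apply: SBL.
have xA : SA x by rewrite xE -[1]scale1r; apply: subA.
have yB : SB y by rewrite yE -[1]scale1r; apply: subB.
have Ex : E x = 0 by rewrite xE linearB /= Ea (nc_unit E_prob) subrr.
have Ey : E y = 0 by rewrite yE linearB /= Eb (nc_unit E_prob) subrr.
have v1 d z : SA d -> SB z -> E z = 0 -> tau E (d * z) = 0.
  by move=> dA zB Ez; have := @vanish d x z 0%N dA xA zB Ex Ez; rewrite mulr1 /tau => ->.
have ay : tau E (a * y) = 0 by exact: v1.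
have aay : tau E (a * a * y) = 0 by apply: v1 => //; apply: SAM.
have ayxy : tau E (a * y * (x * y)) = 0.
  by have := @vanish a x y 1%N aA xA yB Ex Ey; rewrite expr1 /tau => ->.
have ta : tau E a = 1 by rewrite /tau Ea.
have tb : tau E b = 1 by rewrite /tau Eb.
have ayy : tau E (a * (y * y)) = tau E (y * y).
  pose c := E (y * y).
  have -> : a * (y * y) = a * (y * y - c *: 1) + c *: a.
    by rewrite mulrBr -scalerAr mulr1 subrK.
  rewrite tauD v1 ?add0r //; first by rewrite /tau linearZ /= Ea mulr1.
    by apply: subB; apply: SBM.
  by rewrite linearB linearZ /= (nc_unit E_prob) mulr1 subrr.
have eb : b = 1 + y by rewrite yE addrCA subrr addr0.
split; first by rewrite eb mulrDr mulr1 tauD ta ay addr0.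
have -> : (a * b) ^+ 2 = a ^+ 2 + a * a * y + a * y * a + (a * (y * y) + a * y * (x * y)).
  by rewrite !expr2 eb xE; ncring.
rewrite !tauD (tauC E_prob (a * y)) mulrA aay ayxy ayy.
have -> : y * y = b ^+ 2 - b - b + 1 by rewrite yE expr2; ncring.
by rewrite !(tauB, tauD) tb tau1 //; lra.
Qed.

Variables (M : nat) (a b : A) (w zb : R -> R).
Hypotheses (aA : SA a) (bB : SB b).
Hypothesis Ea : forall k, E (a ^+ k) = (tau E (a ^+ k))%:C%C.
Hypothesis Eb : forall k, E (b ^+ k) = (tau E (b ^+ k))%:C%C.

Let K := M.+1.
Let u s := tau E (geom K (w s *:: a)) - 1.
Let Z s := (1 + u s) / u s * (w s * zb s).

Hypotheses (wO : Osc w 1) (zO : Osc zb 1).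
Hypothesis u_low : exists c e : R, [/\ 0 < c, 0 < e & forall s, 0 < s < e -> c * s <= u s].

Lemma u_order : Osc u 1.
Proof.
apply: (@Osc_eq _ _ (fun s => tau E (geom K (w s *:: a) - 1))) => [s _|].
  by rewrite tauB tau1.
apply: Osc_tau => //; apply: Oop_geom_sub1.
exact: (Oop_scale wO (Oop_cst a)).
Qed.

Lemma u_inv_order : Osc (fun s => (u s)^-1 * s) 0.
Proof.
have [c [e [c0 e0 H]]] := u_low.
apply: (Ole_near e0) (Ole_cst c^-1) => s se.
have s0 : 0 < s by case/andP: se.
have us := H s se; have u0 : 0 < u s by apply: lt_le_trans us; apply: mulr_gt0.
rewrite normrM normfV !gtr0_norm // ler_pdivrMl // ler_pdivlMr // mulrC.
exact: us.
Qed.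

Lemma lambda_order : Osc (fun s => (1 + u s) / u s * s) 0.
Proof.
apply: (@Osc_eq _ _ (fun s => (1 + u s) * ((u s)^-1 * s))) => [s _|].
  by rewrite mulrA.
apply: (@Osc_mul _ _ _ 0 0); last exact: u_inv_order.
by apply: Osc_add; [exact: Osc_cst | exact: Ole_weak u_order].
Qed.

Lemma Z_order : Osc Z 1.
Proof. exact: (Osc_shift lambda_order (Osc_mul wO zO)). Qed.

(** Apply the trace to [resolvent_product]: the left side is (1 + u) (1 + u + delta) by
    [E_geom_alternating]. Dividing by 1 + u, the new discrepancy is delta - tau (err) / (1 + u), of
    order [K]. *)
Lemma free_product_moments :
  Osc (fun s => tau E (geom K (zb s *:: b)) - 1 - u s) K ->
  Osc (fun s => tau E (geom K (Z s *:: (a * b))) - 1 - u s) K.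
Proof.
set delta := (X in Osc X K) => dO.
have [c [e [c0 e0 ulow]]] := u_low.
have uO := u_order; have lO := lambda_order.
pose v s := (1 + u s)^-1.
have vO : Osc v 0.
  apply: (Ole_near e0) (Ole_cst 1) => s se.
  have us : 0 <= u s by apply: le_trans (ulow s se); rewrite mulr_ge0 ?ltW //; case/andP: se.
  have pu : 0 < 1 + u s by rewrite ltr_wpDr.
  by rewrite /v gtr0_norm ?invr_gt0 // invf_le1 // lerDl.
pose a' s := w s *:: a; pose b' s := zb s *:: b.
have a'O : Oop a' 1 by exact: (Oop_scale wO (Oop_cst a)).
have b'O : Oop b' 1 by exact: (Oop_scale zO (Oop_cst b)).
pose f s := geom K (a' s); pose g s := geom K (b' s).
have fO : Oop f 0 by apply/Oop_geom/(Ole_weak _ a'O).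
have gO : Oop g 0 by apply/Oop_geom/(Ole_weak _ b'O).
have f1O : Oop (fun s => f s - 1) 1 by exact: Oop_geom_sub1.
have g1O : Oop (fun s => g s - 1) 1 by exact: Oop_geom_sub1.
pose x s := f s - (1 + u s) *:: 1; pose y s := g s - (1 + u s + delta s) *:: 1.
have xO : Oop x 1.
  apply: (@Oop_eq _ _ _ (fun s => (f s - 1) - u s *:: 1)) => [s _|].
    by rewrite /x rscaleDl rscale1 opprD addrA.
  by apply: Oop_sub => //; apply: (Oop_scale uO (Oop_cst 1)).
have dO1 : Osc delta 1 by apply: Ole_weak dO.
have yO : Oop y 1.
  apply: (@Oop_eq _ _ _ (fun s => (g s - 1) - (u s + delta s) *:: 1)) => [s _|].
    by rewrite /y -addrA [(1 + _) *:: _]rscaleDl rscale1 opprD addrA.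
  by apply: Oop_sub => //; apply: (Oop_scale (Osc_add uO dO1) (Oop_cst 1)).
pose p s := ((1 + u s) / u s) *:: (a' s * b' s).
have pO : Oop p 1 by apply: (Oop_shift lO); exact: (Oop_mul a'O b'O).
pose q s := (u s * (1 + u s))^-1 *:: (x s * y s).
have qO : Oop q 1.
  apply: (Oop_shift _ (Oop_mul xO yO)).
  apply: (@Osc_eq _ _ (fun s => v s * ((u s)^-1 * s))) => [s _|].
    by rewrite invfM mulrA (mulrC (v s)).
  exact: (Osc_mul vO u_inv_order).
pose T s := geom K (q s).
have TO : Oop T 0 by apply/Oop_geom/(Ole_weak _ qO).
have expO (F : R -> A) : Oop F 1 -> Oop (fun s => F s ^+ K) K.
  by move=> FO; have := Oop_exp K FO; rewrite muln1.
have dO' : Oop (fun s => delta s *:: (1 : A)) K.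
  by have := Oop_scale dO (Oop_cst 1); rewrite addn0.
pose err1 s := res_err1 K (a' s) (b' s) (u s) (delta s).
have err1O : Oop err1 K.
  apply: Oop_sub; first exact: (Oop_mul fO dO').
  (* Each of the three terms has order K + 1, so that the simple pole of lambda still leaves order
     [K]. *)
  apply: (Oop_shift lO); apply: Oop_add; first apply: Oop_add.
  - exact: (Oop_mul f1O dO').
  - by have := Oop_mul (expO _ a'O) (Oop_mul b'O gO); rewrite addn1.
  - exact: (Oop_mul f1O (expO _ b'O)).
have u1O : Osc (fun s => 1 + u s) 0.
  by apply: Osc_add; [exact: Osc_cst | exact: Ole_weak uO].
pose err2 s := res_err2 K (a' s) (b' s) (u s) (delta s).
have err2O : Oop err2 K.
  apply: Oop_sub; first by have := Oop_mul err1O TO; rewrite addn0.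
  exact: (Oop_scale u1O (expO _ qO)).
have one_sub (F : R -> A) : Oop F 1 -> Oop (fun s => 1 - F s) 0.
  by move=> FO; apply: Oop_sub; [exact: Oop_cst | exact: Ole_weak FO].
have gTfO : Oop (fun s => g s * T s * f s) 0 := Oop_mul (Oop_mul gO TO) fO.
pose err3 s := res_err3 K (a' s) (b' s) (u s) (delta s).
have err3O : Oop err3 K.
  apply: Oop_add; first apply: Oop_sub.
  - by have := Oop_mul (Oop_mul (expO _ a'O) (one_sub _ pO)) gTfO; rewrite !addn0.
  - exact: (Oop_scale u1O (expO _ a'O)).
  - by have := Oop_mul (Oop_mul (one_sub _ a'O) err2O) fO; rewrite addn0.
pose err s := res_err K (a' s) (b' s) (u s) (delta s).
have errO : Oop err K.
  apply: Oop_add; first exact: (Oop_mul (Oop_geom K (Ole_weak (leq0n _) pO)) err3O).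
  by have := Oop_mul (expO _ pO) gTfO; rewrite addn0.
apply: (@Osc_near _ _ (fun s => delta s - tau E (err s) * v s) _ e e0) => [s se|]; last first.
  apply: Osc_sub => //.
  by have := Osc_mul (Osc_tau E_prob errO) vO; rewrite addn0.
have s0 : 0 < s by case/andP: se.
have us : 0 < u s by apply: lt_le_trans (ulow s se); rewrite mulr_gt0.
have u1 : 1 + u s != 0 by rewrite gt_eqF // addr_gt0.
have := @resolvent_product _ _ K (a' s) (b' s) (u s) (delta s) (lt0r_neq0 us) u1.
rewrite -/(f s) -/(g s) -/(x s) -/(y s) -/(q s) -/(T s) -/(p s) -/(err s) => /(congr1 (tau E)).
have geomA t : SA (geom K (t *:: a)).
  rewrite /geom; elim: (K) => [|k IH].
    by rewrite big_ord0 -(addNr 1) -scaleN1r; apply: SAL.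
  rewrite big_ord_recr /= addrC rscaleXn /rscale; apply: SAL => //.
  by elim: (k) => [|k' IH']; rewrite ?expr0 // exprS; apply: SAM.
have geomB t : SB (geom K (t *:: b)).
  rewrite /geom; elim: (K) => [|k IH].
    by rewrite big_ord0 -(addNr 1) -scaleN1r; apply: SBL.
  rewrite big_ord_recr /= addrC rscaleXn /rscale; apply: SBL => //.
  by elim: (k) => [|k' IH']; rewrite ?expr0 // exprS; apply: SBM.
have geomE z t : (forall k, E (z ^+ k) = (tau E (z ^+ k))%:C%C) ->
    E (geom K (t *:: z)) = (tau E (geom K (t *:: z)))%:C%C.
  move=> Ez; rewrite /geom tau_sum linear_sum rmorph_sum /=; apply: eq_bigr => i _.
  by rewrite rscaleXn tau_rscale linearZ /= Ez rmorphM.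
have ef : E (f s) = (1 + u s)%:C%C by rewrite /f /a' geomE // /u addrC subrK.
have eg : E (g s) = (1 + u s + delta s)%:C%C.
  by rewrite /g /b' geomE // /delta; congr (_%:C%C); ring.
rewrite /T /q E_geom_alternating; [|exact: geomA|exact: geomB|exact: ef|exact: eg].
rewrite tauD tau_rscale /p /a' /b' rscaleAl rscaleAr !rscaleA -(mulrA _ (w s)) -/(Z s) => h.
have -> : tau E (geom K (Z s *:: (a * b))) =
    ((1 + u s) * (1 + u s + delta s) - tau E (err s)) / (1 + u s).
  by rewrite h addrK [RHS]mulrC mulKf.
by rewrite /v; field.
Qed.

End FreeProduct.

(** * Majorants and subordination *)

Section Majorants.
Variable R : realType.
Implicit Types (p q : {poly R}) (f g : R -> R) (k : nat).

Lemma Osc_horner p : Osc (fun s => p.[s]) 0.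
Proof.
elim/poly_ind: p => [|p c IH].
  by apply: (Osc_eq _ (Osc_cst 0)) => s _; rewrite horner0.
apply: (@Osc_eq _ _ (fun s => p.[s] * s + c)) => [s _|]; first by rewrite hornerMXaddC.
apply: Osc_add; last exact: Osc_cst.
exact: (Osc_mul IH (Ole_weak (leq0n 1) (@Osc_id R))).
Qed.

Lemma Osc_horner_dvd p k : 'X^k %| p -> Osc (fun s => p.[s]) k.
Proof.
move=> /dvdpP[q ->].
apply: (@Osc_eq _ _ (fun s => q.[s] * s ^+ k)) => [s _|]; first by rewrite hornerM hornerXn.
have := Osc_exp k (@Osc_id R); rewrite muln1; exact: Osc_mul (Osc_horner q).
Qed.

Lemma Osc_comp p f : Osc f 0 -> Osc (fun s => p.[f s]) 0.
Proof.
move=> f0; elim/poly_ind: p => [|p c IH].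
  by apply: (Osc_eq _ (Osc_cst 0)) => s _; rewrite horner0.
apply: (@Osc_eq _ _ (fun s => p.[f s] * f s + c)) => [s _|]; first by rewrite hornerMXaddC.
by apply: Osc_add; [exact: (Osc_mul IH f0) | exact: Osc_cst].
Qed.

Lemma Osc_comp_sub p f g k : Osc f 0 -> Osc g 0 -> Osc (fun s => f s - g s) k ->
  Osc (fun s => p.[f s] - p.[g s]) k.
Proof.
move=> f0 g0 fg; elim/poly_ind: p => [|p c IH].
  have := Osc_mul fg (Osc_cst 0); rewrite addn0; apply: Osc_eq => s _.
  by rewrite !horner0 mulr0 subrr.
have := Osc_mul IH f0; rewrite addn0 => /Osc_add /(_ (Osc_mul (Osc_comp p g0) fg)).
by apply: Osc_eq => s _; rewrite !hornerMXaddC; ring.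
Qed.

(** The way back from estimates in s to coefficients: the constant term is O(s), hence zero, and
    division by s lowers the order by one. *)
Lemma coef_eq0_Osc p k i : Osc (fun s => p.[s]) k -> (i < k)%N -> p`_i = 0.
Proof.
elim: k p i => // k IH p i; elim/poly_ind: p => [|p c _] pO ik.
  by rewrite coef0.
have pE s : (p * 'X + c%:P).[s] = p.[s] * s + c by rewrite hornerMXaddC.
have c0 : c = 0.
  have : Osc (fun=> c) 1.
    apply: (@Osc_eq _ _ (fun s => (p * 'X + c%:P).[s] - p.[s] * s)) => [s _|].
      by rewrite pE addrC addKr.
    apply: Osc_sub; first exact: Ole_weak pO.
    exact: (Osc_mul (Osc_horner p) (@Osc_id R)).
  move=> [C [e [C0 e0 H]]]; apply/eqP; rewrite -normr_eq0; apply/eqP.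
  apply/eqP; rewrite eq_le normr_ge0 andbT; apply/ler_addgt0Pr => d d0; rewrite add0r.
  have [s [s0 se sd]] : exists s, [/\ 0 < s, s < e & C * s <= d].
    exists (Num.min (e / 2) (d / C)); rewrite lt_min gt_min !divr_gt0 //; split=> //.
      by apply/orP; left; lra.
    by rewrite mulrC -ler_pdivlMr // ge_min lexx orbT.
  by apply: le_trans (H s _) _; rewrite ?s0 ?expr1.
rewrite c0 addr0 coefMX; case: i ik => //= i ik; apply: IH ik.
apply: Ole_shift => // ; apply: Ole_dom pO => s s0.
by rewrite pE c0 addr0 normrM (gtr0_norm s0).
Qed.

Definition majorant p q : Prop := forall i, `|p`_i| <= q`_i.

Lemma majorant_ge0 p q i : majorant p q -> 0 <= q`_i.
Proof. by move=> H; apply: le_trans (H i). Qed.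

Lemma majorant0 : majorant 0 0.
Proof. by move=> i; rewrite coef0 normr0. Qed.

Lemma majorantC (c : R) : majorant c%:P `|c|%:P.
Proof. by move=> i; rewrite !coefC; case: eqP; rewrite ?normr0. Qed.

Lemma majorantX : majorant 'X 'X.
Proof. by move=> i; rewrite coefX normr_nat. Qed.

Lemma majorantD p p' q q' : majorant p p' -> majorant q q' -> majorant (p + q) (p' + q').
Proof.
by move=> H H' i; rewrite !coefD; apply: le_trans (ler_normD _ _) (lerD _ _).
Qed.

Lemma majorantN p p' : majorant p p' -> majorant (- p) p'.
Proof. by move=> H i; rewrite coefN normrN. Qed.

Lemma majorantM p p' q q' : majorant p p' -> majorant q q' -> majorant (p * q) (p' * q').
Proof.
move=> H H' i; rewrite !coefM; apply: le_trans (ler_norm_sum _ _ _) _.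
by apply: ler_sum => j _; rewrite normrM ler_pM.
Qed.

Lemma majorant_exp p p' k : majorant p p' -> majorant (p ^+ k) (p' ^+ k).
Proof.
move=> H; elim: k => [|k IH]; last by rewrite !exprS; apply: majorantM.
by have := majorantC 1; rewrite normr1.
Qed.

Lemma majorant_sum (I : Type) (r : seq I) (F G : I -> {poly R}) :
  (forall i, majorant (F i) (G i)) ->
  majorant (\sum_(i <- r) F i) (\sum_(i <- r) G i).
Proof.
move=> H; elim/big_ind2: _ => // [|*]; [exact: majorant0 | exact: majorantD].
Qed.

(** A range of summation independent of [p] lets two compositions be compared term by term. *)
Lemma comp_poly_wide N p q : (size p <= N)%N -> p \Po q = \sum_(i < N) p`_i *: q ^+ i.
Proof.
move=> sp; have -> : p = \poly_(i < N) p`_i.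
  apply/polyP => i; rewrite coef_poly; case: ltnP => // Ni.
  by rewrite nth_default // (leq_trans sp).
rewrite poly_def linear_sum /=; apply: eq_bigr => i _.
by rewrite comp_polyZ comp_Xn_poly -poly_def coef_poly ltn_ord.
Qed.

Lemma majorant_comp p p' q q' : majorant p p' -> majorant q q' ->
  majorant (p \Po q) (p' \Po q').
Proof.
move=> H H'; rewrite !(@comp_poly_wide (maxn (size p) (size p'))) ?leq_maxl ?leq_maxr //.
apply: majorant_sum => i; rewrite -!mul_polyC; apply: majorantM; last exact: majorant_exp.
by move=> j; rewrite !coefC; case: eqP; rewrite ?normr0.
Qed.

Lemma horner_ge0 p q s : majorant p q -> 0 <= s -> 0 <= q.[s].
Proof.
move=> H s0; rewrite horner_coef sumr_ge0 // => i _.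
by rewrite mulr_ge0 ?exprn_ge0 // (majorant_ge0 _ H).
Qed.

Lemma horner_mono p q s t : majorant p q -> 0 <= s -> s <= t -> q.[s] <= q.[t].
Proof.
move=> H s0 st; rewrite !horner_coef ler_sum // => i _.
by rewrite ler_wpM2l ?(majorant_ge0 _ H) // lerXn2r // nnegrE // (le_trans s0).
Qed.

Lemma majorant_coef_le p q s i : majorant p q -> 0 <= s -> p`_i * s ^+ i <= q.[s].
Proof.
move=> H s0; have q0 j : 0 <= q`_j * s ^+ j.
  by rewrite mulr_ge0 ?exprn_ge0 // (majorant_ge0 _ H).
apply: (@le_trans _ _ (q`_i * s ^+ i)).
  by rewrite ler_wpM2r ?exprn_ge0 //; apply: le_trans (H i); apply: ler_norm.
rewrite (@horner_coef_wide _ (maxn i.+1 (size q))) ?leq_maxr //.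
have ii : (i < maxn i.+1 (size q))%N by rewrite leq_max leqnn.
by rewrite (bigD1 (Ordinal ii)) //= lerDl sumr_ge0.
Qed.

Lemma geometric_le (x : R) N : 0 <= x < 1 -> \sum_(k < N) x ^+ k <= (1 - x)^-1.
Proof.
move=> /andP[x0 x1]; have p : 0 < 1 - x by rewrite subr_gt0.
rewrite -[_^-1]mul1r ler_pdivlMr // mulrC.
have -> : (1 - x) * \sum_(k < N) x ^+ k = 1 - x ^+ N.
  by rewrite -[RHS]opprB subrX1 -mulNr opprB.
by rewrite gerBl exprn_ge0.
Qed.

End Majorants.

Definition trunc_psi (R : realType) (m : nat -> R) M (t : R) : R :=
  \sum_(k < M.+1) m k * t ^+ k - 1.

(** * The subordination function and its radius of control *)

Section Subordination.
Variables (R : realType) (n M : nat) (L : R) (m : nat -> R).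
Hypotheses (n_gt0 : (0 < n)%N) (M_gt0 : (0 < M)%N) (L_ge1 : 1 <= L).
Hypotheses (m0 : m 0%N = 1) (m1 : m 1%N = 1) (m_le : forall k, `|m k.+1| <= L ^+ k).

(* [omega] solves omega = 'X * phi(omega) modulo 'X^(M+2); the suffix [h] marks
   the dominating polynomials, obtained by putting [L ^+ k] for [m k.+1]. *)
Let U : {poly R} := \poly_(k < M) m k.+1.
Let kappa : {poly R} := U * \sum_(j < M.+1) (- ('X * U)) ^+ j.
Let phi := kappa ^+ n.-1.
Let om := fix om j : {poly R} := if j is j'.+1 then 'X * (phi \Po om j') else 0.
Let omega := om M.+1.

Let Uh : {poly R} := \poly_(k < M) L ^+ k.
Let kappah : {poly R} := Uh * \sum_(j < M.+1) ('X * Uh) ^+ j.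
Let phih := kappah ^+ n.-1.
Let omh := fix omh j : {poly R} := if j is j'.+1 then 'X * (phih \Po omh j') else 0.
Let omegah := omh M.+1.

Lemma trunc_psiE t : trunc_psi m M t = t * U.[t].
Proof.
rewrite /trunc_psi big_ord_recl m0 expr0 mulr1 addrC addKr horner_poly mulr_sumr.
by apply: eq_bigr => i _; rewrite exprS mulrCA.
Qed.

(** [kappa] is U / (1 + 'X U) up to the tail of the geometric sum; at w, with u = w U(w), this is u
    / (w (1 + u)). *)
Lemma kappaE : kappa * (1 + 'X * U) = U * (1 - (- ('X * U)) ^+ M.+1).
Proof.
rewrite /kappa -mulrA; congr (_ * _).
set q := - ('X * U); have -> : 1 + 'X * U = 1 - q by rewrite opprK.
by rewrite -[RHS]opprB subrX1 -mulNr opprB mulrC.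
Qed.

Lemma majorant_U : majorant U Uh.
Proof.
by move=> i; rewrite !coef_poly; case: ltnP; rewrite ?normr0.
Qed.

Lemma majorant_phi : majorant phi phih.
Proof.
apply/majorant_exp/majorantM; first exact: majorant_U.
apply: majorant_sum => j; apply/majorant_exp/majorantN/majorantM; last exact: majorant_U.
exact: majorantX.
Qed.

Lemma majorant_om j : majorant (om j) (omh j).
Proof.
elim: j => [|j IH]; first exact: majorant0.
by apply/majorantM/majorant_comp; [exact: majorantX | exact: majorant_phi |].
Qed.

(** At this radius 2 L y = 1 / (2 n), so 1 / (1 - 2 L y) has an (n-1)-st power of at most 2. *)
Let y := (4 * L * n%:R)^-1.

Lemma y_bounds : 0 < y /\ L * y * (4 * n%:R) = 1.
Proof.
have L0 : 0 < L by apply: lt_le_trans L_ge1.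
have n0 : 0 < n%:R :> R by rewrite ltr0n.
split; first by rewrite invr_gt0 !mulr_gt0.
by rewrite /y; field; rewrite !gt_eqF.
Qed.

Lemma Ly_le : 0 < L * y <= 4^-1 /\ y <= L * y.
Proof.
have [y0 e] := y_bounds; have n1 : 1 <= n%:R :> R by rewrite ler1n.
have L0 : 0 < L by apply: lt_le_trans L_ge1.
have Ly0 : 0 < L * y by apply: mulr_gt0.
have h1 : 0 <= (L * y) * (n%:R - 1) by rewrite mulr_ge0 ?(ltW Ly0) // subr_ge0.
have h2 : 0 <= (L - 1) * y by rewrite mulr_ge0 ?(ltW y0) // subr_ge0.
by split; [rewrite Ly0 /=|]; move: (y) e h1 h2 => t; lra.
Qed.

Lemma Uh_le : 0 <= Uh.[y] <= (1 - L * y)^-1.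
Proof.
have [/andP[Ly0 Ly4] _] := Ly_le.
rewrite (horner_ge0 majorant_U) ?(ltW y_bounds.1) //=.
rewrite horner_poly (eq_bigr (fun i : 'I_M => (L * y) ^+ i)); last first.
  by move=> i _; rewrite exprMn.
by apply: geometric_le; lra.
Qed.

Lemma yUh_le : 0 <= y * Uh.[y] <= y / (1 - L * y).
Proof.
have [y0 _] := y_bounds; have /andP[U0 U1] := Uh_le.
by rewrite mulr_ge0 ?(ltW y0) //= ler_pM2l.
Qed.

(** The two geometric series together give 1 / (1 - L y - y), and y <= L y because 1 <= L. *)
Lemma kappah_le : 0 <= kappah.[y] <= (1 - (2 * n%:R)^-1)^-1.
Proof.
have [y0 e] := y_bounds; have /andP[U0 U1] := Uh_le; have /andP[yU0 yU1] := yUh_le.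
have [/andP[Ly0 Ly4] yLy] := Ly_le.
have n1 : 1 <= n%:R :> R by rewrite ler1n.
have d0 : 0 < 1 - L * y by lra.
have r1 : y / (1 - L * y) < 1 by rewrite ltr_pdivrMr //; lra.
have g : \sum_(j < M.+1) (y * Uh.[y]) ^+ j <= (1 - y / (1 - L * y))^-1.
  apply: le_trans (geometric_le _ _) _; first by rewrite yU0 (le_lt_trans yU1).
  by rewrite lef_pV2 ?posrE; lra.
have -> : kappah.[y] = Uh.[y] * \sum_(j < M.+1) (y * Uh.[y]) ^+ j.
  rewrite /kappah hornerM horner_sum; congr (_ * _); apply: eq_bigr => j _.
  by rewrite horner_exp hornerM hornerX.
have g0 : 0 <= \sum_(j < M.+1) (y * Uh.[y]) ^+ j.
  by apply: sumr_ge0 => j _; rewrite exprn_ge0.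
rewrite mulr_ge0 //=; apply: le_trans (ler_pM _ _ U1 g) _ => //.
rewrite -invfM lef_pV2 ?posrE.
- have -> : (1 - L * y) * (1 - y / (1 - L * y)) = 1 - L * y - y by field; lra.
  have -> : (2 * n%:R)^-1 = 2 * (L * y).
    have nz : 2 * n%:R != 0 :> R by rewrite gt_eqF //; lra.
    have e2 : 2 * n%:R * (2 * (L * y)) = 1 by apply: etrans e; move: (y) => t; ring.
    by apply: (mulfI nz); rewrite mulfV // e2.
  lra.
- by rewrite mulr_gt0 // subr_gt0.
- by rewrite subr_gt0 invf_lt1; lra.
Qed.

(** With x = 1 / (2 n), Bernoulli's inequality gives (1 - x)^(n-1) >= 1 - (n - 1) x >= 1/2. *)
Lemma phih_le : 0 <= phih.[y] <= 2.
Proof.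
have /andP[k0 k1] := kappah_le.
rewrite /phih horner_exp exprn_ge0 //=.
have n1 : 1 <= n%:R :> R by rewrite ler1n.
have x1 : (2 * n%:R)^-1 <= 2^-1 :> R by rewrite lef_pV2 ?posrE; lra.
have x0 : 0 < (2 * n%:R)^-1 :> R by rewrite invr_gt0; lra.
set x := (2 * n%:R)^-1 in k1 x1 x0.
have nx : n%:R * x = 2^-1 by rewrite /x; field; lra.
have bernoulli k : 1 - k%:R * x <= (1 - x) ^+ k.
  elim: k => [|k IH]; first by rewrite mul0r subr0 expr0.
  rewrite exprS -natr1; apply: (@le_trans _ _ ((1 - x) * (1 - k%:R * x))); last first.
    by rewrite ler_wpM2l //; lra.
  have k0' : 0 <= k%:R :> R by []; nra.
apply: (@le_trans _ _ ((1 - x)^-1 ^+ n.-1)).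
  by rewrite lerXn2r // nnegrE // (le_trans k0).
have b2 : 2^-1 <= (1 - x) ^+ n.-1.
  apply: le_trans (bernoulli _); rewrite -subn1 natrB // mulrBl nx; lra.
rewrite exprVn -[X in _ <= X]invrK lef_pV2 ?posrE //.
by apply: lt_le_trans b2; lra.
Qed.

(** The bound reproduces itself: the next iterate at y / 2 is at most (y / 2) times the value of
    [phih] at y, which is at most 2. Hence the final radius y / 2 = 1 / (8 L n). *)
Lemma omh_le j : 0 <= (omh j).[y / 2] <= y.
Proof.
have [y0 _] := y_bounds; elim: j => [|j /andP[IH0 IH1]]; first by rewrite horner0 lexx ltW.
rewrite /= hornerM hornerX horner_comp.
have h0 := horner_ge0 majorant_phi IH0.
have h1 := horner_mono majorant_phi IH0 IH1.
have /andP[_ h2] := phih_le.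
apply/andP; split; first by rewrite mulr_ge0 // divr_ge0 // ltW.
by have := le_trans h1 h2; nra.
Qed.

Lemma psi_omegah_le : ((1 + 'X * Uh) \Po omegah).[y / 2] <= 2.
Proof.
have [y0 _] := y_bounds; have /andP[w0 w1] := omh_le M.+1.
have [/andP[Ly0 Ly4] yLy] := Ly_le.
rewrite horner_comp hornerD hornerC hornerM hornerX -/omegah.
have mU : majorant ('X * U) ('X * Uh) by apply: majorantM majorant_U; exact: majorantX.
have := horner_mono mU w0 w1; rewrite !hornerM !hornerX -/omegah.
have /andP[_ yU1] := yUh_le.
have : y / (1 - L * y) <= 1 by rewrite ler_pdivrMr; lra.
lra.
Qed.

Lemma comp_poly_sub_dvd (p q r : {poly R}) : (q - r) %| (p \Po q) - (p \Po r).
Proof.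
elim/poly_ind: p => [|p c IH]; first by rewrite !comp_poly0 subrr dvdp0.
rewrite !comp_polyD !comp_polyM !comp_polyX !comp_polyC.
have -> : (p \Po q) * q + c%:P - ((p \Po r) * r + c%:P) =
  ((p \Po q) - (p \Po r)) * q + (p \Po r) * (q - r) by ring.
by apply: dvdp_add; [exact: dvdp_mulr | exact: dvdp_mull].
Qed.

(** The factor 'X gains one order per iteration, because q - r divides p(q) - p(r). *)
Lemma om_stable j : 'X^(j.+1) %| om j.+1 - om j.
Proof.
elim: j => [|j IH]; first by rewrite /= subr0 dvdp_mulr.
have -> : om j.+2 - om j.+1 = 'X * ((phi \Po om j.+1) - (phi \Po om j)).
  by rewrite /= mulrBr.
by rewrite exprS dvdp_mul // (dvdp_trans IH) // comp_poly_sub_dvd.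
Qed.

Lemma om_stable_le j k : (j <= k)%N -> 'X^(j.+1) %| om k - om j.
Proof.
move=> /subnKC <-; elim: (k - j)%N => [|d IH]; first by rewrite addn0 subrr dvdp0.
rewrite addnS -(subrK (om (j + d)%N) (om (j + d).+1)) -addrA; apply: dvdp_add => //.
by apply: dvdp_trans (om_stable _); rewrite dvdp_exp2l // ltnS leq_addr.
Qed.

Let w s := omega.[s].
Let u s := w s * U.[w s].
Let z s := w s * ((1 + u s) / u s * w s) ^+ n.-1.

Lemma U_0 : U.[0] = 1.
Proof. by rewrite horner_coef0 coef_poly M_gt0. Qed.

Lemma omega_sub : Osc (fun s => w s - s) 2.
Proof.
apply: (@Osc_eq _ _ (fun s => (omega - 'X).[s])) => [s _|].
  by rewrite hornerD hornerN hornerX.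
(* U(0) = m 1 = 1 gives phi(0) = 1, so the first iterate is 'X. *)
apply: Osc_horner_dvd; suff e : 'X = om 1 by rewrite [X in _ - X]e; apply: om_stable_le.
rewrite /= comp_poly0r -horner_coef0; suff -> : phi.[0] = 1 by rewrite mulr1.
rewrite /phi horner_exp /kappa hornerM U_0 mul1r horner_sum big_ord_recl expr0 hornerC.
rewrite big1 ?addr0 ?expr1n // => i _.
by rewrite exprS hornerM hornerN hornerM hornerX mul0r oppr0 mul0r.
Qed.

Lemma omega_order : Osc w 1.
Proof.
apply: (@Osc_eq _ _ (fun s => (w s - s) + s)) => [s _|]; first by rewrite subrK.
by apply: Osc_add (@Osc_id R); apply: Ole_weak omega_sub.
Qed.

Lemma omega_fix : Osc (fun s => w s - s * phi.[w s]) M.+2.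
Proof.
apply: (@Osc_eq _ _ (fun s => - (om M.+2 - om M.+1).[s])) => [s _|].
  by rewrite hornerD hornerN /= hornerM hornerX horner_comp opprB.
by apply/Osc_opp/Osc_horner_dvd/om_stable.
Qed.

Lemma u_sub : Osc (fun s => u s - s) 2.
Proof.
apply: (@Osc_eq _ _ (fun s => (w s - s) + w s * (U.[w s] - U.[0]))) => [s _|].
  by rewrite U_0 /u; ring.
apply: Osc_add; first exact: omega_sub.
apply: (Osc_mul omega_order (Osc_comp_sub _ _ _ _)).
- exact: Ole_weak omega_order.
- exact: Osc_cst.
- by apply: Osc_eq omega_order => s _; rewrite subr0.
Qed.

Lemma u_omega_low : exists c e : R, [/\ 0 < c, 0 < e & forall s, 0 < s < e -> c * s <= u s].
Proof.
(* From u >= s - C s^2, where C s <= 1/2. *)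
have [C [e [C0 e0 H]]] := u_sub; exists 2^-1, (Num.min e (2 * C)^-1); split=> //.
  by rewrite lt_min e0 invr_gt0 mulr_gt0.
move=> s; rewrite lt_min => /and3P[s0 se sC].
have := H s; rewrite s0 se => /(_ isT); rewrite ler_norml => /andP[h _].
have : C * s ^+ 2 <= 2^-1 * s.
  rewrite expr2 mulrA ler_pM2r // -ler_pdivlMl // -invfM mulrC; exact: ltW.
move: h; lra.
Qed.

(** [z] is the inverse of [omega] to this order. By [kappaE], kappa(w) times [rho] is the truncation
    factor [v], so z - s is the defect of the fixed-point equation times rho^(n-1), plus s (v^(n-1)
    - 1). *)
Lemma omega_z_sub : Osc (fun s => z s - s) M.+1.
Proof.
have [c [e [c0 e0 ulow]]] := u_omega_low.
have uO : Osc u 1 by apply: (@Osc_eq _ _ (fun s => (u s - s) + s)) => [s _|];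
  [rewrite subrK | apply: Osc_add (@Osc_id R); apply: Ole_weak u_sub].
pose rho s := (1 + u s) / u s * w s.
have rhoO : Osc rho 0.
  apply: (Osc_shift _ omega_order).
  apply: (@Osc_eq _ _ (fun s => (1 + u s) * ((u s)^-1 * s))) => [s _|]; first by rewrite mulrA.
  apply: (@Osc_mul _ _ _ 0 0).
    by apply: Osc_add; [exact: Osc_cst | exact: Ole_weak uO].
  apply: (Ole_near e0) (Ole_cst c^-1) => s se.
  have s0 : 0 < s by case/andP: se.
  have us := ulow s se; have u0 : 0 < u s by apply: lt_le_trans us; apply: mulr_gt0.
  by rewrite normrM normfV !gtr0_norm // ler_pdivrMl // ler_pdivlMr // mulrC.
pose v s := 1 - (- u s) ^+ M.+1.
have vO : Osc (fun s => v s - 1) M.+1.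
  apply: (@Osc_eq _ _ (fun s => - (- u s) ^+ M.+1)) => [s _|].
    by rewrite /v addrAC subrr add0r.
  by have := Osc_opp (Osc_exp M.+1 (Osc_opp uO)); rewrite muln1.
have vnO : Osc (fun s => v s ^+ n.-1 - 1) M.+1.
  have cO : Osc (fun=> 1 : R) 0 by exact: Osc_cst.
  have v0 : Osc v 0.
    apply: (@Osc_eq _ _ (fun s => (v s - 1) + 1)) => [s _|]; first by rewrite subrK.
    by apply: Osc_add => //; apply: Ole_weak vO.
  apply: Osc_eq (Osc_comp_sub 'X^(n.-1) v0 cO vO) => s _.
  by rewrite !hornerXn expr1n.
apply: (@Osc_near _ _ (fun s =>
  (w s - s * phi.[w s]) * rho s ^+ n.-1 + s * (v s ^+ n.-1 - 1)) _ e e0).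
  move=> s se; have s0 : 0 < s by case/andP: se.
  have u0 : 0 < u s by apply: lt_le_trans (ulow s se); rewrite mulr_gt0.
  have e1 : phi.[w s] * rho s ^+ n.-1 = v s ^+ n.-1.
    rewrite /phi horner_exp -exprMn; congr (_ ^+ _).
    have := kappaE; move: (kappa) => k /(congr1 (fun p => p.[w s])).
    rewrite !hornerM !hornerD !hornerN !horner_exp !hornerN !hornerC !hornerM !hornerX.
    rewrite -/(u s) -/(v s) => h.
    have w0 : w s != 0.
      by apply: contra_eq_neq (esym (gt_eqF u0)) => w0; rewrite /u w0 mul0r eqxx.
    have -> : rho s = (1 + u s) * (w s / u s) by rewrite /rho mulrAC mulrA.
    rewrite (mulrA k.[w s]) h mulrAC.
    have -> : U.[w s] * (w s / u s) = 1 by rewrite mulrA (mulrC U.[_]) divff // gt_eqF.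
    by rewrite mul1r.
  rewrite mulrBl -[s * _ * _]mulrA e1 /z -/(rho s); ring.
apply: Osc_add.
  apply: (@Ole_weak _ _ M.+2) => //.
  have r0 : Osc (fun s => rho s ^+ n.-1) 0 by have := Osc_exp n.-1 rhoO; rewrite muln0.
  by have := Osc_mul omega_fix r0; rewrite addn0.
apply: (@Ole_weak _ _ (1 + M.+1)) => //; exact: (Osc_mul (@Osc_id R) vnO).
Qed.

(** As z(s) agrees with s to order M + 1, the hypothesis can be read at s itself. Two polynomials
    then agree to that order, so [mu i] is a coefficient of the composite of 1 + 'X U with [omega],
    and its majorant is controlled at y / 2. *)
Lemma moment_transfer (mu : nat -> R) :
  Osc (fun s => trunc_psi mu M (z s) - u s) M.+1 ->
  forall i, (i <= M)%N -> mu i * (y / 2) ^+ i <= 2.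
Proof.
move=> H i iM.
pose Q : {poly R} := \poly_(k < M.+1) mu k.
have idO : Osc (fun s : R => s) 0 by apply: Ole_weak (@Osc_id R).
have zO : Osc z 0.
  apply: (@Osc_eq _ _ (fun s => (z s - s) + s)) => [s _|]; first by rewrite subrK.
  by apply: Osc_add => //; apply: Ole_weak omega_z_sub.
have QO : Osc (fun s => (Q - ((1 + 'X * U) \Po omega)).[s]) M.+1.
  apply: Osc_eq (Osc_sub H (Osc_comp_sub Q zO idO omega_z_sub)) => s _.
  rewrite hornerD hornerN horner_comp hornerD hornerC hornerM hornerX -/(w s) -/(u s).
  by rewrite /trunc_psi {2}/Q horner_poly; ring.
have mui : mu i = ((1 + 'X * U) \Po omega)`_i.
  have := coef_eq0_Osc QO (iM : (i < M.+1)%N).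
  by rewrite coefB coef_poly ltnS iM => /eqP; rewrite subr_eq0 => /eqP.
rewrite mui; apply: le_trans _ psi_omegah_le; apply: majorant_coef_le.
  apply: majorant_comp (majorant_om _).
  have := majorantC (1 : R); rewrite normr1 => m11; apply: majorantD => //.
  by apply: majorantM majorant_U; apply: majorantX.
by have [y0 _] := y_bounds; rewrite divr_ge0 // ltW.
Qed.

Lemma subordination_function : exists w' : R -> R, let u' t := trunc_psi m M (w' t) in
  [/\ Osc w' 1,
      exists c e : R, [/\ 0 < c, 0 < e & forall s, 0 < s < e -> c * s <= u' s] &
      forall mu : nat -> R,
        Osc (fun t =>
          trunc_psi mu M (w' t * ((1 + u' t) / u' t * w' t) ^+ n.-1) - u' t) M.+1 ->
        forall i, (i <= M)%N -> mu i * (y / 2) ^+ i <= 2].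
Proof.
have uE t : trunc_psi m M (w t) = u t by rewrite trunc_psiE.
exists w; split; first exact: omega_order.
  have [c [e [c0 e0 H]]] := u_omega_low.
  by exists c, e; split=> // t te; rewrite uE; apply: H.
move=> mu H; apply: moment_transfer; apply: Osc_eq H => t _.
by rewrite !uE.
Qed.

End Subordination.

Lemma subordination_moment_bound (R : realType) (n : nat) (L : R) (m mu : nat -> R) :
  (0 < n)%N -> 1 <= L -> m 0%N = 1 -> m 1%N = 1 ->
  (forall k, `|m k.+1| <= L ^+ k) ->
  (forall M (w : R -> R), let u s := trunc_psi m M (w s) in
    Osc w 1 ->
    (exists c e : R, [/\ 0 < c, 0 < e & forall s, 0 < s < e -> c * s <= u s]) ->
    Osc (fun s => trunc_psi mu M (w s * ((1 + u s) / u s * w s) ^+ n.-1) - u s) M.+1) ->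
  forall i, mu i * (8 * L * n%:R)^-1 ^+ i <= 2.
Proof.
move=> n0 L1 m0 m1 mL H i.
have e : (8 * L * n%:R)^-1 = (4 * L * n%:R)^-1 / 2.
  by rewrite -invfM; congr (_^-1); ring.
(* The truncation degree depends on the moment: i + 1 is positive and reaches the i-th
   coefficient. *)
have [w [wO low bound]] := subordination_function n0 (ltn0Sn i) L1 m0 m1 mL.
by rewrite e; apply: bound => //; apply: H.
Qed.

(** * Products of free variables *)

Lemma gen_star_subalgebraP (R : realType) (A : cstarAlgType R) (x : A) :
  star_subalgebra (gen_star_subalgebra x).
Proof.
have mem (y : A) : (y \in gen_star_subalgebra x) <->
    forall S, star_subalgebra S -> ([set x] `<=` S)%classic -> y \in S.
  rewrite in_setE; split=> [H S Sal xS|H S [Sal xS]].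
    by rewrite in_setE; apply: H.
  by have := H S Sal xS; rewrite in_setE.
split; [split|].
- by apply/mem => S [[]].
- move=> c y z /mem Hy /mem Hz; apply/mem => S HS xS; have [[_ L _] _] := HS.
  by apply: L; [apply: Hy | apply: Hz].
- move=> y z /mem Hy /mem Hz; apply/mem => S HS xS; have [[_ _ L] _] := HS.
  by apply: L; [apply: Hy | apply: Hz].
- move=> y /mem Hy; apply/mem => S HS xS; have [_ L] := HS.
  by apply: L; apply: Hy.
Qed.

Lemma gen_star_subalgebra_id (R : realType) (A : cstarAlgType R) (x : A) :
  gen_star_subalgebra x x.
Proof. by move=> S [_]; apply. Qed.

Lemma mulr_pow_swap (S : pzRingType) (x y : S) k :
  (x * y) ^+ k.+1 = x * (y * x) ^+ k * y.
Proof.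
elim: k => [|k IH]; first by rewrite expr1 expr0 mulr1.
by rewrite exprS IH (exprS (y * x)) !mulrA.
Qed.

Section FreeProducts.
Variables (R : realType) (A : cstarAlgType R) (E : {scalar A}).
Hypothesis E_prob : nc_probability E.
Variables (n : nat) (X : 'I_n -> A) (i0 : 'I_n).
Hypothesis X_free : free_variables E X.
Hypothesis X_id : identically_distributed E X.
Hypothesis X_nz : E (star (X i0) * X i0) != 0.

Lemma tau_pow_swap x y k : tau E ((x * y) ^+ k) = tau E ((y * x) ^+ k).
Proof.
case: k => [|k]; first by rewrite !expr0.
by rewrite mulr_pow_swap tauC // mulrA -exprS.
Qed.

Lemma second_moment_tau x : second_moment E x = tau E (star x * x).
Proof. by []. Qed.

Let s := second_moment E (X i0).
(** Extended to all natural numbers, with [X i0] outside the range, so that partial products are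
    indexed by [nat]. *)
Let Y k := X (insubd i0 k).
Let a k := s^-1 *:: (Y k * star (Y k)).
Let m j := tau E (a 0 ^+ j).
Let prodY k := \prod_(j < k) Y j.
Let P k := (s^-1) ^+ k *:: (star (prodY k) * prodY k).
Let L := opnorm (X i0) ^+ 2 / s.

Lemma second_moment_gt0 : 0 < s.
Proof.
rewrite lt_def tau_ge0 // andbT; apply: contraNneq X_nz => s0.
by rewrite (E_pos_tau E_prob) -second_moment_tau -/s s0.
Qed.

Lemma star_a k : star (a k) = a k.
Proof. by rewrite /a star_rscale starM starK. Qed.

Lemma star_P k : star (P k) = P k.
Proof. by rewrite /P star_rscale starM starK. Qed.

Lemma moment_word x k :
  E ((x * star x) ^+ k) = mixed_moment E x (flatten (nseq k [:: false; true])).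
Proof.
rewrite /mixed_moment; congr (E _); elim: k => [|k IH].
  by rewrite expr0 big_nil.
by rewrite exprS IH /= !big_cons /= mulrA.
Qed.

Lemma tau_a k j : tau E (a k ^+ j) = m j.
Proof.
rewrite /m /a !rscaleXn !tau_rscale /tau !moment_word; congr (_ * complex.Re _).
exact: X_id.
Qed.

Lemma tau_star_X i : tau E (X i * star (X i)) = s.
Proof.
rewrite /s second_moment_tau (tauC E_prob (star _)) -[X i * _]expr1 -[X i0 * _]expr1.
by rewrite /tau !moment_word; congr complex.Re; apply: X_id.
Qed.

Lemma m_0 : m 0 = 1.
Proof. by rewrite /m expr0 tau1. Qed.

Lemma m_1 : m 1 = 1.
Proof. by rewrite /m expr1 /a tau_rscale tau_star_X mulVf // gt_eqF // second_moment_gt0. Qed.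

Lemma E_a k : E (a k) = 1.
Proof. by rewrite (E_sa_real E_prob (star_a k)) -[a k]expr1 tau_a m_1. Qed.

(** Computing the norm at one index is enough, since the moments of [a k] do not depend on k. *)
Lemma opnorm_a : exists k, opnorm (a k) = L.
Proof.
exists i0; rewrite /a /Y valKd opnorm_rscale ger0_norm ?invr_ge0 ?(ltW second_moment_gt0) //.
by rewrite -{1}[X i0]starK opnorm_starM opnorm_star mulrC.
Qed.

(** One factor of a^(j+1) is split as Y (star Y) / s and moved around the trace. It then contributes
    its mean 1 and not its norm, hence the exponent j. *)
Lemma m_le j : `|m j.+1| <= L ^+ j.
Proof.
have [k Lk] := opnorm_a; have s0 := second_moment_gt0.
have bound h : star h = h -> opnorm h <= L ^+ j ->
    s^-1 * tau E (star (Y k) * h * Y k) <= L ^+ j.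
  move=> hs hL; rewrite ler_pdivrMl //; apply: le_trans (tau_conj_le E_prob _ hs) _.
  by rewrite (tauC E_prob (star _)) tau_star_X mulrC ler_pM2l.
have aj : opnorm (a k ^+ j) <= L ^+ j by rewrite -Lk; apply: opnormX_le.
have asj : star (a k ^+ j) = a k ^+ j by rewrite starX star_a.
have e : m j.+1 = s^-1 * tau E (star (Y k) * a k ^+ j * Y k).
  rewrite -(tau_a k) exprSr {2}/a rscaleAr tau_rscale; congr (_ * _).
  by rewrite mulrA (tauC E_prob) mulrA.
rewrite ler_norml e; apply/andP; split; last exact: bound.
rewrite lerNl -mulrN -tauN -mulNr -mulrN; apply: bound; first by rewrite starN asj.
by rewrite opnormN.
Qed.

Lemma L_ge1 : 1 <= L.
Proof.
have [k <-] := opnorm_a; have := normr_tau_le E_prob (a k).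
by rewrite -[a k in X in X -> _]expr1 tau_a m_1 normr1.
Qed.

Lemma P_S k : P k.+1 = s^-1 *:: (star (Y k) * P k * Y k).
Proof.
rewrite /P /prodY big_ord_recr /= starM rscaleAr rscaleAl rscaleA -exprS.
by rewrite !mulrA.
Qed.

Lemma tau_P_S k j : tau E (P k.+1 ^+ j) = tau E ((a k * P k) ^+ j).
Proof.
rewrite P_S -mulrA -rscaleAr tau_pow_swap rscaleAl -mulrA -rscaleAr.
by rewrite -/(a k) tau_pow_swap.
Qed.

Let B i := gen_star_subalgebra (X i).
Let B_star i : star_subalgebra (B i) := gen_star_subalgebraP (X i).
Let J k : pred 'I_n := fun i => (i < k)%N.

Lemma Y_mem k : B (insubd i0 k) (Y k).
Proof. exact: gen_star_subalgebra_id. Qed.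

Lemma a_mem k : B (insubd i0 k) (a k).
Proof.
apply: (subalg_scale B_star); apply: (subalg_mul B_star); first exact: Y_mem.
exact: (subalg_star B_star (@Y_mem k)).
Qed.

Lemma P_mem k : (k <= n)%N -> join_alg E B (J k) (P k).
Proof.
move=> kn.
have YJ l : (l < k)%N -> join_alg E B (J k) (Y l) /\ join_alg E B (J k) (star (Y l)).
  move=> lk; have Jl : J k (insubd i0 l).
    by rewrite /J insubdK // /in_mem /= (leq_trans lk).
  split; apply: (join_alg_sub E_prob B_star Jl); first exact: Y_mem.
  exact: (subalg_star B_star (@Y_mem l)).
have prodJ l : (l <= k)%N ->
    join_alg E B (J k) (prodY l) /\ join_alg E B (J k) (star (prodY l)).
  elim: l => [|l IH] lk.
    by rewrite /prodY big_ord0 star1; split; apply: join_alg1.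
  have [h1 h2] := IH (ltnW lk); have [h3 h4] := YJ _ lk.
  rewrite /prodY big_ord_recr /= starM; split; exact: join_alg_mul.
have [h1 h2] := prodJ _ (leqnn k).
rewrite /P /rscale -[_ *: _]addr0; apply: join_alg_lin; first exact: join_alg_mul.
by rewrite -(addNr 1) -scaleN1r; apply: join_alg_lin; apply: join_alg1.
Qed.

Lemma a_P_vanish k : (k < n)%N -> forall d x y j,
  B (insubd i0 k) d -> B (insubd i0 k) x -> join_alg E B (J k) y ->
  E x = 0 -> E y = 0 -> E (d * y * (x * y) ^+ j) = 0.
Proof.
move=> kn d x y j dB xB yJ.
apply: (@free_join_vanish _ _ _ E_prob _ _ B_star X_free (J k) (insubd i0 k)) => //.
by rewrite /J insubdK // ltnn.
Qed.

Lemma P_0 : P 0 = 1.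
Proof. by rewrite /P /prodY big_ord0 mulr1 star1 expr0 rscale1. Qed.

Lemma E_sa_pow x k : star x = x -> E (x ^+ k) = (tau E (x ^+ k))%:C%C.
Proof. by move=> xs; apply: E_sa_real => //; rewrite starX xs. Qed.

Lemma tau_P_step k : (k < n)%N -> E (P k) = 1 ->
  tau E (a k * P k) = 1 /\
  tau E ((a k * P k) ^+ 2) = tau E (a k ^+ 2) + tau E (P k ^+ 2) - 1.
Proof.
move=> kn EP.
apply: (tau_free_mul E_prob _ _ _ _ _ _ (a_P_vanish kn)) => //.
- exact: subalg_one B_star _.
- by move=> x y; apply: (subalg_mul B_star).
- by move=> c x y; apply: (subalg_lin B_star).
- exact: join_alg1.
- by move=> x y; apply: join_alg_mul.
- by move=> c x y; apply: join_alg_lin.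
- exact: a_mem.
- exact/P_mem/ltnW.
- exact: E_a.
Qed.

Lemma E_P k : (k <= n)%N -> E (P k) = 1.
Proof.
elim: k => [|k IH] kn; first by rewrite P_0 (nc_unit E_prob).
rewrite (E_sa_real E_prob (star_P _)) -[P _]expr1 tau_P_S expr1.
by rewrite (tau_P_step kn (IH (ltnW kn))).1.
Qed.

Lemma tau_P_sqr k : (k <= n)%N -> tau E (P k ^+ 2) = 1 + k%:R * (m 2 - 1).
Proof.
elim: k => [|k IH] kn; first by rewrite P_0 expr1n tau1 // mul0r addr0.
rewrite tau_P_S (tau_P_step kn (E_P (ltnW kn))).2 tau_a IH ?(ltnW kn) //.
rewrite -natr1; ring.
Qed.

Lemma tau_geom K r x : tau E (geom K (r *:: x)) = \sum_(j < K) tau E (x ^+ j) * r ^+ j.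
Proof.
rewrite /geom tau_sum; apply: eq_bigr => j _.
by rewrite rscaleXn tau_rscale mulrC.
Qed.

Section Iterate.
Variables (M : nat) (w : R -> R).
Let u t := trunc_psi m M (w t).
Hypothesis w_order : Osc w 1.
Hypothesis u_low : exists c e : R, [/\ 0 < c, 0 < e & forall t, 0 < t < e -> c * t <= u t].
Let z k t := w t * ((1 + u t) / u t * w t) ^+ k.

Lemma tau_geom_a k t : tau E (geom M.+1 (w t *:: a k)) - 1 = u t.
Proof.
by rewrite tau_geom /u /trunc_psi; congr (_ - _); apply: eq_bigr => j _; rewrite tau_a.
Qed.

(** [P 1] has the moments of [a 0], at the parameter w. Each further factor is one use of
    [free_product_moments] for [a k.+1] and [P k.+1], the latter built from Y 0, ..., Y k only; it
    multiplies the parameter by (1 + u) / u * w. *)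
Lemma product_moments k : (k < n)%N ->
  Osc (fun t => trunc_psi (fun j => tau E (P k.+1 ^+ j)) M (z k t) - u t) M.+1 /\ Osc (z k) 1.
Proof.
elim: k => [|k IH] kn.
  split; last by apply: Osc_eq w_order => t _; rewrite /z expr0 mulr1.
  have h : Osc (fun=> 0 : R) M.+1.
    by exists 1, 1; split=> // t /andP[t0 _]; rewrite normr0 mul1r exprn_ge0 // ltW.
  apply: Osc_eq h => t _; rewrite /z expr0 mulr1 /u /trunc_psi.
  rewrite (eq_bigr (fun j : 'I_M.+1 => m j * w t ^+ j)) ?subrr // => j _.
  by rewrite tau_P_S P_0 mulr1 tau_a.
have [IH1 IH2] := IH (ltnW kn).
have uE t : tau E (geom M.+1 (w t *:: a k.+1)) - 1 = u t by exact: tau_geom_a.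
have low : exists c e : R, [/\ 0 < c, 0 < e &
    forall t, 0 < t < e -> c * t <= tau E (geom M.+1 (w t *:: a k.+1)) - 1].
  have [c [e [c0 e0 H]]] := u_low.
  by exists c, e; split=> // t te; rewrite uE; apply: H.
have zE t : z k.+1 t = (1 + u t) / u t * (w t * z k t) by rewrite /z exprS; ring.
have Ea j : E (a k.+1 ^+ j) = (tau E (a k.+1 ^+ j))%:C%C by apply/E_sa_pow/star_a.
have EP j : E (P k.+1 ^+ j) = (tau E (P k.+1 ^+ j))%:C%C by apply/E_sa_pow/star_P.
have aB := @a_mem k.+1.
have PB := P_mem (ltnW kn).
split; last first.
  apply: (Osc_eq _ (Z_order E_prob w_order IH2 low)) => t _.
  by rewrite zE uE.
have S1 := subalg_one B_star (insubd i0 k.+1).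
have SM x y := @subalg_mul _ _ _ _ B_star (insubd i0 k.+1) x y.
have SL c x y := @subalg_lin _ _ _ _ B_star (insubd i0 k.+1) c x y.
have T1 := @join_alg1 _ _ E _ B (J k.+1).
have TM x y := @join_alg_mul _ _ E _ B (J k.+1) x y.
have TL c x y := @join_alg_lin _ _ E _ B (J k.+1) c x y.
have := free_product_moments E_prob S1 SM SL T1 TM TL (a_P_vanish kn)
  aB PB Ea EP w_order IH2 low.
move=> H; apply: Osc_eq (H _) => [t _|]; last first.
  by apply: Osc_eq IH1 => t _; rewrite uE tau_geom.
rewrite uE -zE tau_geom; congr (_ - _ - _); apply: eq_bigr => j _.
by rewrite tau_P_S.
Qed.

End Iterate.

Lemma opnorm_P_le : opnorm (P n) <= 8 * L * n%:R.
Proof.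
have n0 : (0 < n)%N by apply: leq_ltn_trans (ltn_ord i0).
have L1 := L_ge1; have n1 : 1 <= n%:R :> R by rewrite ler1n.
have L0 : 0 < L := lt_le_trans ltr01 L1.
have t0 : 0 < 8 * L * n%:R by apply: mulr_gt0; [apply: mulr_gt0 | rewrite ltr0n].
apply: (opnorm_le_of_moments E_prob (C := 2) (star_P n)) => // k.
rewrite -ler_pdivrMr ?exprn_gt0 // -exprVn.
apply: (@subordination_moment_bound _ n L m (fun j => tau E (P n ^+ j))) => //.
- exact: m_0.
- exact: m_1.
- exact: m_le.
move=> M w u wO low.
have := @product_moments M w wO low n.-1; rewrite prednK // => /(_ (leqnn _)) [].
by [].
Qed.

Lemma prodY_n : prodY n = \prod_(i < n) X i.
Proof. by apply: eq_bigr => i _; rewrite /Y valKd. Qed.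

Lemma opnorm_prod_sqr : opnorm (\prod_(i < n) X i) ^+ 2 = s ^+ n * opnorm (P n).
Proof.
have s0 := second_moment_gt0.
rewrite -prodY_n -opnorm_starM /P opnorm_rscale normrX normfV (gtr0_norm s0).
by rewrite mulrA -exprMn divff ?expr1n ?mul1r // gt_eqF.
Qed.

(** [gamma] is formed with star X X and the moments [m] with X star X; traciality identifies
    them. *)
Lemma gammaE : gamma E (X i0) ^+ 2 = m 2 - 1.
Proof.
have s0 := second_moment_gt0; have sn : s != 0 by rewrite gt_eqF.
set h := (s^-1 *:: (star (X i0) * X i0)).
have hE : (E (star (X i0) * X i0))^-1 *: (star (X i0) * X i0) = h.
  by rewrite (E_pos_tau E_prob) -second_moment_tau -/s /h /rscale fmorphV.
have hs : star h = h by rewrite /h star_rscale starM starK.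
have th : tau E (h ^+ 2) = m 2.
  rewrite /h rscaleXn tau_rscale tau_pow_swap -(tau_a i0) /a /Y valKd.
  by rewrite rscaleXn tau_rscale.
have t1 : tau E h = 1 by rewrite /h tau_rscale -second_moment_tau mulVf.
have Eh : E h = 1 by rewrite (E_sa_real E_prob hs) t1.
rewrite /gamma hE /stddev /Defs.variance second_moment_tau hs -expr2 th Eh.
rewrite (_ : Normc.normc (1 : R[i]) = 1) ?expr1n; last exact: Normc.normc1.
rewrite sqr_sqrtr // subr_ge0 -th; have := tau_sqr_le E_prob h.
by rewrite t1 expr1n hs expr2.
Qed.

Lemma opnorm_prod_upper :
  opnorm (\prod_(i < n) X i) ^+ 2 <= 8 * n%:R * opnorm (X i0) ^+ 2 * s ^+ n.-1.
Proof.
have s0 := second_moment_gt0; have n0 : (0 < n)%N := leq_ltn_trans (leq0n _) (ltn_ord i0).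
rewrite opnorm_prod_sqr.
apply: (@le_trans _ _ (s ^+ n * (8 * L * n%:R))).
  by rewrite ler_pM2l ?exprn_gt0 // opnorm_P_le.
(* The division by [s] in [L] turns s^n into s^(n-1). *)
rewrite -{1}(prednK n0) exprS /L le_eqVlt; apply/orP; left; apply/eqP.
by field; rewrite gt_eqF.
Qed.

Lemma opnorm_prod_lower :
  gamma E (X i0) ^+ 2 * n%:R * s ^+ (2 * n) <= opnorm (\prod_(i < n) X i) ^+ 4.
Proof.
have s0 := second_moment_gt0.
have -> : opnorm (\prod_(i < n) X i) ^+ 4 = s ^+ (2 * n) * opnorm (P n) ^+ 2.
  by rewrite (exprM _ 2 2) opnorm_prod_sqr exprMn mulnC exprM.
rewrite mulrC ler_pM2l ?exprn_gt0 // gammaE.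
have h := normr_tau_le E_prob (P n ^+ 2).
have := le_trans (ler_norm _) (le_trans h (opnormX_le (P n) 2)).
(* The summand 1 in 1 + n gamma^2 is dropped. *)
rewrite tau_P_sqr //; lra.
Qed.

End FreeProducts.

Theorem theorem2 (R : realType) :
  exists c : R, 0 < c /\
    forall (A : cstarAlgType R) (E : {scalar A}) (n : nat) (X : 'I_n -> A),
      nc_probability E ->
      (1 <= n)%N ->
      free_variables E X ->
      identically_distributed E X ->
      (forall i, E (star (X i) * X i) != 0) ->
      let Pi_n := \prod_(i < n) X i in
      forall i : 'I_n,
        opnorm Pi_n <= c * opnorm (X i) * Num.sqrt n%:R
                         * second_moment E (X i) `^ ((n%:R - 1) / 2)
        /\
        opnorm Pi_n >= gamma E (X i) `^ (1 / 2) * n%:R `^ (1 / 4)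
                         * second_moment E (X i) `^ (n%:R / 2).
Proof.
(* The squared upper bound carries the constant 8, which is at most 3^2. *)
exists 3; split=> // A E n X E_prob n_gt0 X_free X_id X_nz Pi_n i.
have s0 := second_moment_gt0 E_prob (X_nz i).
have up := opnorm_prod_upper E_prob X_free X_id (X_nz i).
have low := opnorm_prod_lower E_prob X_free X_id (X_nz i).
rewrite -/Pi_n in up low; set s := second_moment E (X i) in s0 up low *.
have g0 : 0 <= gamma E (X i) by exact: sqrtr_ge0.
have powR_exp (x r : R) k j : 0 <= x -> r * k%:R = j%:R -> (x `^ r) ^+ k = x ^+ j.
  by move=> x0 e; rewrite -powR_mulrn ?powR_ge0 // -powRrM e powR_mulrn.
have X0 := opnorm_ge0 (X i); have P0 := opnorm_ge0 Pi_n.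
split.
  rewrite -(ler_pXn2r (n := 2)) ?nnegrE // ?mulr_ge0 ?powR_ge0 ?sqrtr_ge0 //.
  apply: le_trans up _; rewrite 3!exprMn sqr_sqrtr //.
  rewrite (powR_exp _ _ _ n.-1) ?(ltW s0) //; last first.
    by rewrite divfK // -subn1 natrB.
  rewrite ler_pM2r ?exprn_gt0 //; have := sqr_ge0 (opnorm (X i)).
  have : 0 <= n%:R * opnorm (X i) ^+ 2 by rewrite mulr_ge0 ?sqr_ge0.
  nra.
(* Fourth powers clear the exponents 1/2, 1/4 and n/2 at once. *)
rewrite -(ler_pXn2r (n := 4)) ?nnegrE // ?mulr_ge0 ?powR_ge0 //.
apply: le_trans low; rewrite 2!exprMn (powR_exp _ _ _ 2) //; last by lra.
rewrite (powR_exp _ _ _ 1%N) //; last by lra.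
rewrite expr1 (powR_exp _ _ _ (2 * n)%N) ?(ltW s0) //.
by rewrite natrM; lra.
Qed.
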